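(* Let $\varepsilon\neq 0$ be a real number, let $\psi:S^3_\varepsilon\to S^2(\tfrac12)$ be the Hopf fibration, and let $\beta:I\to S^2(\tfrac12)$ be an immersed regular curve parametrized by arc length. Then the Hopf torus $\Sigma=\bigcup_{s\in I}\psi^{-1}(\beta(s))$ is a proper biharmonic surface in the Berger 3-sphere $S^3_\varepsilon$ if and only if $\varepsilon^2<1$ and the curve $\beta$ is (an arc of) a circle of radius $r=\frac{1}{2\sqrt{2-\varepsilon^2}}$ on the base sphere $S^2(\tfrac12)$.
   Context: All manifolds and maps are smooth. Let $g$ be the standard metric on the unit sphere $S^3\subset\mathbb{R}^4$, and let $S^2(\tfrac12)\subset\mathbb{R}^3$ be the 2-sphere of radius $\tfrac12$ (Gauss curvature $4$). The Hopf map $\psi:S^3\to S^2(\tfrac12)$ is $$\psi(x^1,x^2,x^3,x^4)=\tfrac12\big(2x^1x^3+2x^2x^4,\;2x^2x^3-2x^1x^4,\;(x^1)^2+(x^2)^2-(x^3)^2-(x^4)^2\big),$$ equivalently $\psi(z,w)=\tfrac12(2z\bar w,|z|^2-|w|^2)$ with $z=x^1+ix^2$, $w=x^3+ix^4$. Let $T^VS^3=\ker d\psi$ and let $T^HS^3$ be its $g$-orthogonal complement. For real $\varepsilon\ne0$ the Berger sphere is $S^3_\varepsilon=(S^3,g_\varepsilon)$, where $g_\varepsilon=g$ on $T^HS^3\times T^HS^3$, $g_\varepsilon=\varepsilon^2 g$ on $T^VS^3\times T^VS^3$, and $g_\varepsilon=0$ on $T^HS^3\times T^VS^3$. The map $\psi:S^3_\varepsilon\to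 S^2(\tfrac12)$ is a Riemannian submersion. The radius of a circle in $S^2(\tfrac12)$ is its Euclidean radius as a circle in $\mathbb{R}^3$. For a map $\varphi:(M,g_M)\to(N,h)$ of Riemannian manifolds, the tension field is $\tau(\varphi)=\mathrm{Trace}_{g_M}\nabla d\varphi$; $\varphi$ is harmonic if $\tau(\varphi)=0$, and biharmonic if $\mathrm{Trace}_{g_M}(\nabla^\varphi\nabla^\varphi-\nabla^\varphi_{\nabla^M})\tau(\varphi)-\mathrm{Trace}_{g_M}R^N(d\varphi,\tau(\varphi))d\varphi=0$, where $R^N(X,Y)Z=[\nabla^N_X,\nabla^N_Y]Z-\nabla^N_{[X,Y]}Z$. A surface is biharmonic if the isometric immersion defining it is a biharmonic map; it is proper biharmonic if it is biharmonic and not harmonic (i.e. not minimal). *)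

(* Defs.v *)
From mathcomp Require Import all_boot all_order all_algebra.
From mathcomp Require Import all_classical all_reals all_analysis.

Set Implicit Arguments.
Unset Strict Implicit.
Unset Printing Implicit Defensive.

Import Order.TTheory GRing.Theory Num.Theory.
Import numFieldNormedType.Exports.

Local Open Scope classical_set_scope.
Local Open Scope ring_scope.

(* [f] is of class C^k on [U]; only meaningful for [U] open, which is how it
   is used below. *)
Fixpoint Ck {R : realType} {V W : normedModType R} (k : nat) (U : set V)
    (f : V -> W) : Prop :=
  if k is k'.+1 then
    (forall x, U x -> differentiable f x) /\
    (forall v, Ck k' U (fun x => 'D_v f x))
  else forall x, U x -> {for x, continuous f}.

Definition smooth {R : realType} {V W : normedModType R} (U : set V)
    (f : V -> W) : Prop := forall k, Ck k U f.

(* The library norm on row vectors is the sup norm, so Euclidean lengths are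
   always expressed through [dot]. *)
Definition dot {R : realType} {n : nat} (u v : 'rV[R]_n) : R :=
  \sum_(i < n) u 0 i * v 0 i.

Definition partial {R : realType} {m : nat} {W : normedModType R}
    (i : 'I_m.+1) (f : 'rV[R]_m.+1 -> W) : 'rV[R]_m.+1 -> W :=
  fun u => 'D_(delta_mx 0 i) f u.

Section sphere.
Context {R : realType}.
Notation R4 := 'rV[R]_4.
Notation R3 := 'rV[R]_3.

Definition S3 : set R4 := [set p | dot p p = 1].

Definition S2half : set R3 := [set y | dot y y = (2^-1) ^+ 2].

Definition hopf (x : R4) : R3 :=
  let x1 := x 0 0 in let x2 := x 0 1 in let x3 := x 0 2 in let x4 := x 0 3 in
  2^-1 *: \row_j [:: 2 * x1 * x3 + 2 * x2 * x4;
                     2 * x2 * x3 - 2 * x1 * x4;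
                     x1 ^+ 2 + x2 ^+ 2 - x3 ^+ 2 - x4 ^+ 2]`_j.

(* T_p S^3, for p in [S3] *)
Definition tangent (p v : R4) : Prop := dot p v = 0.

Definition vertical (p v : R4) : Prop := tangent p v /\ 'D_v hopf p = 0.

Definition horizontal (p v : R4) : Prop :=
  tangent p v /\ forall w, vertical p w -> dot v w = 0.

(* The metric of S^3_eps.  Only the values [g p v w] with p in S^3 and v, w in
   T_p S^3 have a meaning, and the last three clauses determine them; [g] is a
   smooth extension of this tensor to R^4, so that the derivative of a function
   p |-> g p (X p) (Y p) along S^3 is its ambient directional derivative. *)
Definition berger_metric (eps : R) (g : R4 -> R4 -> R4 -> R) : Prop :=
  [/\ (forall v w, smooth setT (fun p => g p v w)),
      (forall p v w, g p v w = g p w v) /\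
      (forall p a v v' w, g p (a *: v + v') w = a * g p v w + g p v' w),
      (forall p v w, S3 p -> horizontal p v -> horizontal p w ->
         g p v w = dot v w),
      (forall p v w, S3 p -> vertical p v -> vertical p w ->
         g p v w = eps ^+ 2 * dot v w) &
      (forall p v w, S3 p -> horizontal p v -> vertical p w -> g p v w = 0)].

(* Vector fields on S^3 are represented by smooth extensions to R^4. *)
Definition vector_field (X : R4 -> R4) : Prop :=
  smooth setT X /\ forall p, S3 p -> tangent p (X p).

Definition lie_bracket (X Y : R4 -> R4) : R4 -> R4 :=
  fun p => 'D_(X p) Y p - 'D_(Y p) X p.

(* Every connection on T S^3 is, on extended vector fields, the flat connection
   of R^4 plus a smooth family [Gam] of bilinear maps (its Christoffel symbols
   in the ambient coordinates; they include the component normal to S^3). *)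
Definition covd (Gam : R4 -> R4 -> R4 -> R4) (X Y : R4 -> R4) : R4 -> R4 :=
  fun p => 'D_(X p) Y p + Gam p (X p) (Y p).

Definition connection (Gam : R4 -> R4 -> R4 -> R4) : Prop :=
  [/\ (forall v w, smooth setT (fun p => Gam p v w)),
      (forall p a v v' w,
         Gam p (a *: v + v') w = a *: Gam p v w + Gam p v' w),
      (forall p a v w w',
         Gam p v (a *: w + w') = a *: Gam p v w + Gam p v w') &
      (forall X Y, vector_field X -> vector_field Y ->
         forall p, S3 p -> tangent p (covd Gam X Y p))].

Definition levi_civita (g : R4 -> R4 -> R4 -> R)
    (Gam : R4 -> R4 -> R4 -> R4) : Prop :=
  [/\ connection Gam,
      (forall X Y, vector_field X -> vector_field Y -> forall p, S3 p ->
         covd Gam X Y p - covd Gam Y X p = lie_bracket X Y p) &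
      (forall X Y Z, vector_field X -> vector_field Y -> vector_field Z ->
         forall p, S3 p ->
         'D_(X p) (fun q => g q (Y q) (Z q)) p =
           g p (covd Gam X Y p) (Z p) + g p (Y p) (covd Gam X Z p))].

Definition curvature (Gam : R4 -> R4 -> R4 -> R4) (X Y Z : R4 -> R4) :
    R4 -> R4 :=
  fun p => covd Gam X (covd Gam Y Z) p - covd Gam Y (covd Gam X Z) p
           - covd Gam (lie_bracket X Y) Z p.

(* A vector field on S^3 whose value at p is v, for p in S^3 and v in T_p S^3. *)
Definition tangent_extension (v : R4) : R4 -> R4 := fun q => v - dot q v *: q.

(* The curvature tensor R(x, y) z at p; by tensoriality it may be computed with
   any extensions of x, y, z to vector fields. *)
Definition riemann (Gam : R4 -> R4 -> R4 -> R4) (p x y z : R4) : R4 :=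
  curvature Gam (tangent_extension x) (tangent_extension y)
    (tangent_extension z) p.

End sphere.

Section maps_into_sphere.
(* Maps F into S^3 from an open set of R^m (here m.+1) with Riemannian metric
   G, i.e. maps from a Riemannian manifold read in local coordinates. *)
Context {R : realType} {m : nat}.
Notation Rm := 'rV[R]_m.+1.
Notation R4 := 'rV[R]_4.
Variables (Gam : R4 -> R4 -> R4 -> R4) (G : Rm -> 'M[R]_m.+1) (F : Rm -> R4).

Definition christoffel (k i j : 'I_m.+1) (u : Rm) : R :=
  2^-1 * \sum_l invmx (G u) k l *
    (partial i (fun w => G w j l) u + partial j (fun w => G w i l) u
     - partial l (fun w => G w i j) u).

(* the pull-back connection nabla^F in the direction of the i-th coordinate
   field, for W a vector field along F *)
Definition covd_along (i : 'I_m.+1) (W : Rm -> R4) : Rm -> R4 :=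
  fun u => partial i W u + Gam (F u) (partial i F u) (W u).

Definition tension (u : Rm) : R4 :=
  \sum_i \sum_j invmx (G u) i j *:
    (covd_along i (partial j F) u
     - \sum_k christoffel k i j u *: partial k F u).

Definition bitension (u : Rm) : R4 :=
  \sum_i \sum_j invmx (G u) i j *:
    (covd_along i (covd_along j tension) u
     - \sum_k christoffel k i j u *: covd_along k tension u)
  - \sum_i \sum_j invmx (G u) i j *:
    riemann Gam (F u) (partial i F u) (tension u) (partial j F u).

End maps_into_sphere.

Section surfaces.
Context {R : realType}.
Notation R4 := 'rV[R]_4.
Notation R3 := 'rV[R]_3.
Notation R2 := 'rV[R]_2.

Definition immersion (U : set R2) (F : R2 -> R4) : Prop :=
  smooth U F /\ forall u, U u -> forall a, 'D_a F u = 0 -> a = 0.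

Definition induced_metric (g : R4 -> R4 -> R4 -> R) (F : R2 -> R4) :
    R2 -> 'M[R]_2 :=
  fun u => \matrix_(i, j) g (F u) (partial i F u) (partial j F u).

(* An immersed surface in S^3 is given by its local parametrizations (U, F). *)
Definition harmonic_surface (g : R4 -> R4 -> R4 -> R)
    (Gam : R4 -> R4 -> R4 -> R4) (S : set (set R2 * (R2 -> R4))) : Prop :=
  forall U F, S (U, F) ->
    forall u, U u -> tension Gam (induced_metric g F) F u = 0.

Definition biharmonic_surface (g : R4 -> R4 -> R4 -> R)
    (Gam : R4 -> R4 -> R4 -> R4) (S : set (set R2 * (R2 -> R4))) : Prop :=
  forall U F, S (U, F) ->
    forall u, U u -> bitension Gam (induced_metric g F) F u = 0.

Definition proper_biharmonic_surface (g : R4 -> R4 -> R4 -> R)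
    (Gam : R4 -> R4 -> R4 -> R4) (S : set (set R2 * (R2 -> R4))) : Prop :=
  biharmonic_surface g Gam S /\ ~ harmonic_surface g Gam S.

Definition hopf_fiber (y : R3) : set R4 := S3 `&` hopf @^-1` [set y].

(* The union over s in J of the fibers over beta s.  As beta may have
   self-intersections this union is an immersed surface: the immersion defining
   it is (s, p) |-> p on the pull-back {(s, p) | p in hopf_fiber (beta s)}, and
   u |-> (sigma u, F u) below is a local parametrization of that pull-back. *)
Definition hopf_torus (J : set R) (beta : R -> R3) :
    set (set R2 * (R2 -> R4)) :=
  [set UF | [/\ open UF.1, immersion UF.1 UF.2 &
     exists sigma : R2 -> R, smooth UF.1 sigma /\
       forall u, UF.1 u ->
         J (sigma u) /\ hopf_fiber (beta (sigma u)) (UF.2 u)]].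

Definition arclength_curve (J : set R) (beta : R -> R3) : Prop :=
  [/\ smooth J beta,
      forall s, J s -> S2half (beta s) &
      forall s, J s -> dot (derive1 beta s) (derive1 beta s) = 1].

(* the Euclidean circle of radius r and center c in the plane orthogonal to n *)
Definition circle (n c : R3) (r : R) : set R3 :=
  [set y | dot n (y - c) = 0 /\ dot (y - c) (y - c) = r ^+ 2].

Definition arc_of_circle (J : set R) (beta : R -> R3) (r : R) : Prop :=
  0 < r /\ exists n c : R3,
    [/\ n != 0, circle n c r `<=` S2half & beta @` J `<=` circle n c r].

End surfaces.

(* Main.v *)
From HB Require Import structures.
Require Import Defs.
From mathcomp Require Import all_boot all_order all_algebra.
From mathcomp Require Import all_classical all_reals all_analysis.
From mathcomp Require Import ring lra.

(** Why the theorem holds.  On a Hopf torus all the geometry can be read off an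
orthonormal moving frame.  Write V = iF for the fibre direction, T for the
horizontal lift of beta', N = iT for the normal, and put a_i = d_i sigma and
b_i = <d_i F, V>, so that d_i F = a_i T + b_i V in any local parametrization F
over beta(sigma).  Quaternionic algebra of the Hopf map together with the
Frenet equations of beta, whose geodesic curvature is k, gives for the
Levi-Civita connection of the Berger metric
  D_i T = t_i N,  D_i N = - t_i T - a_i V,  D_i V = eps^2 a_i N,
with t_i = k a_i + eps^2 b_i ([covd_along_frame]).

The induced metric is G_ij = a_i a_j + eps^2 b_i b_j, and symmetry of second
derivatives makes the pairs (a_i) and (b_i) closed.  Hence a Christoffel sum
of anything linear in a_k, b_k just replaces these by d_i a_j, d_i b_j
([christoffel_sum]), and a G-trace sends a_i a_j to 1, a_i b_j to 0 and
b_i b_j to eps^-2 ([trace_sum]).  So in arbitrary coordinates the tension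
field is k N ([tensionE]), and the bitension field is
  - 3 k k' T + (k'' - k^3 + (4 - 4 eps^2) k) N - 2 k' V
([bitensionE]), the curvature of the ambient space entering through
R(T, N) T = - (4 - 3 eps^2) N and R(V, N) V = - eps^4 N ([riemann_frame]).

Since every point of beta lies under some local parametrization
([local_parametrization]), the torus is proper biharmonic exactly when k is a
nonzero constant with k^2 = 4 - 4 eps^2.  A curve of constant curvature k on the
sphere of radius 1/2 is an arc of a circle of radius r with
r^2 (k^2 + 4) = 1 ([constant_curvature_circle], [circle_curvature]), which is
the radius in the statement.

The connection is only given through its defining properties.  It is determined
on tangent vectors of the sphere by the usual uniqueness argument
([levi_civitaE]); because derivatives in tangent directions see only the values
on the sphere ([sphere_derive]), the ambient extensions of the metric and of the
connection have no influence, and the curvature follows by differentiating an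
explicit polynomial expression ([riemannE]). *)

Set Implicit Arguments.
Unset Strict Implicit.
Unset Printing Implicit Defensive.

Import Order.TTheory GRing.Theory Num.Theory.
Import numFieldNormedType.Exports.

Local Open Scope classical_set_scope.
Local Open Scope ring_scope.

(** * A calculus of directional derivatives *)

Section calculus.
Context {R : realType}.
Implicit Types (V W : normedModType R).

(** Bundling differentiability with the value of one directional derivative lets
the sum, product and chain rules compose without side conditions. *)
Definition hasD V W (f : V -> W) (x v : V) (d : W) :=
  differentiable f x /\ 'D_v f x = d.

Lemma hasD_diff V W (f : V -> W) x v d : hasD f x v d -> differentiable f x.
Proof. by case. Qed.

Lemma hasD_val V W (f : V -> W) x v d : hasD f x v d -> 'D_v f x = d.
Proof. by case. Qed.

Lemma diff_hasD V W (f : V -> W) x v :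
  differentiable f x -> hasD f x v ('D_v f x).
Proof. by []. Qed.

Lemma hasD_eq V W (f : V -> W) x v d d' : hasD f x v d -> d = d' -> hasD f x v d'.
Proof. by move=> h <-. Qed.

Lemma hasD_cst V W (a : W) (x v : V) : hasD (fun _ => a) x v 0.
Proof. by split; [exact: differentiable_cst | exact: derive_cst]. Qed.

Lemma hasD_id V (x v : V) : hasD (fun y => y) x v v.
Proof. by split; [exact: ex_diff | exact: derive_id]. Qed.

Lemma hasDD V W (f g : V -> W) x v df dg :
  hasD f x v df -> hasD g x v dg -> hasD (fun y => f y + g y) x v (df + dg).
Proof.
move=> [Df <-] [Dg <-]; split; first exact: differentiableD.
by rewrite -deriveD//; exact: diff_derivable.
Qed.

Lemma hasDN V W (f : V -> W) x v df :
  hasD f x v df -> hasD (fun y => - f y) x v (- df).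
Proof.
move=> [Df <-]; split; first exact: differentiableN.
by rewrite -deriveN//; exact: diff_derivable.
Qed.

Lemma hasDB V W (f g : V -> W) x v df dg :
  hasD f x v df -> hasD g x v dg -> hasD (fun y => f y - g y) x v (df - dg).
Proof. by move=> hf hg; apply: hasDD => //; apply: hasDN. Qed.

Lemma hasD_sum V W n (f : 'I_n -> V -> W) x v (d : 'I_n -> W) :
  (forall i, hasD (f i) x v (d i)) ->
  hasD (fun y => \sum_(i < n) f i y) x v (\sum_(i < n) d i).
Proof.
elim: n f d => [|n IH] f d H.
  under [X in hasD X]eq_fun do rewrite big_ord0.
  by rewrite big_ord0; exact: hasD_cst.
under [X in hasD X]eq_fun do rewrite big_ord_recr.
by rewrite big_ord_recr; apply: hasDD => //; apply: IH.
Qed.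

Lemma scale_bilinear W : bilinear_for
    (GRing.Scale.Law.clone _ _ *:%R _) (GRing.Scale.Law.clone _ _ *:%R _)
    (fun (a : R) (w : W) => a *: w).
Proof.
split=> [u'|u] a x y /=; first by rewrite scalerDl scalerA.
by rewrite scalerDr !scalerA mulrC.
Qed.

(** The product rule comes from differentiating the bilinear map (a, w) |-> a w
along the pair (k, f). *)
Lemma hasDZ V W (k : V -> R) (f : V -> W) x v dk df :
  hasD k x v dk -> hasD f x v df ->
  hasD (fun y => k y *: f y) x v (dk *: f x + k x *: df).
Proof.
move=> [Dk <-] [Df <-].
pose bM := @bilinear_isBilinear.Build R R W W _ _ _ (@scale_bilinear W).
pose b : {bilinear R -> W -> W} := HB.pack (fun (a : R) (w : W) => a *: w) bM.
have cb : continuous (fun p : R * W => b p.1 p.2) by exact: scale_continuous.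
have Db : differentiable (fun p : R * W => b p.1 p.2) (k x, f x).
  exact: differentiable_bilin.
have Dp : differentiable (fun y => (k y, f y)) x by exact: differentiable_pair.
have DD : differentiable ((fun p : R * W => b p.1 p.2) \o (fun y => (k y, f y))) x.
  exact: differentiable_comp.
split; first exact: DD.
rewrite (deriveE _ DD) diff_comp//=.
rewrite [LHS](congr1 (fun h => h _) (diff_bilin (k x, f x) cb)) diff_pair//=.
by rewrite -!deriveE// addrC.
Qed.

Lemma hasDM V (f g : V -> R) x v df dg :
  hasD f x v df -> hasD g x v dg ->
  hasD (fun y => f y * g y) x v (df * g x + f x * dg).
Proof. exact: hasDZ. Qed.

Lemma hasD_comp V W (f : V -> R) (h : R -> W) x v df dh :
  hasD f x v df -> hasD h (f x) 1 dh -> hasD (fun y => h (f y)) x v (df *: dh).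
Proof.
move=> [Df <-] [Dh <-].
have D : differentiable (h \o f) x by exact: differentiable_comp.
split; first exact: D.
rewrite (deriveE _ D) diff_comp//= -[in LHS](mulr1 ('d f x v)).
by rewrite [_ * 1]/(_ *: _) linearZ /= -!deriveE.
Qed.

(** Differentiability is a local property: the two maps have the same increments
near x, hence the same first-order expansion. *)
Lemma near_differentiable V W (f g : V -> W) x :
  (\near x, f x = g x) -> differentiable f x -> differentiable g x.
Proof.
move=> fg Df; have [dc /eqaddoP fo] := (diff_locallyP x f).1 Df.
have gx : f x = g x by exact: nbhs_singleton fg.
have h2 : \forall y \near (0:V), f (y + x) = g (y + x).
  move: fg; rewrite (near_shift 0 x) subr0; exact: filterS.
have go : g \o shift x = cst (g x) + 'd f x +o_ (0 : V) id.
  apply/eqaddoP => e e0; have h1 := fo e e0.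
  near=> y.
  have E : f (y + x) = g (y + x) by near: y.
  have h3 : `|(f \o shift x - (cst (f x) + 'd f x)) y| <= e * `|id y| by near: y.
  by move: h3; rewrite !fctE /= E gx.
apply/diff_locallyP.
have -> : 'd g x = 'd f x :> (V -> W) by exact: diff_unique.
by split.
Unshelve. all: by end_near. Qed.

Lemma near_open V (U : set V) x (P : V -> Prop) : open U -> U x ->
  (forall y, U y -> P y) -> \near x, P x.
Proof.
by move=> oU Ux UP; near=> y; apply: UP; near: y; exact: open_nbhs_nbhs.
Unshelve. all: by end_near. Qed.

Lemma hasD_open V W (f g : V -> W) (U : set V) x v d : open U -> U x ->
  (forall y, U y -> f y = g y) -> hasD f x v d -> hasD g x v d.
Proof.
move=> oU Ux fg [Df <-].
have n : \near x, f x = g x by exact: near_open fg.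
split; first exact: near_differentiable n Df.
by apply/esym; exact: near_eq_derive.
Qed.

End calculus.

Section row_calculus.
Context {R : realType}.
Implicit Types (V W : normedModType R).

(** Linearity as a bare property, so that it applies to plain functions such as
partially applied bilinear maps; in finite dimension it already gives
continuity. *)
Definition lin n W (l : 'rV[R]_n -> W) :=
  forall a u w, l (a *: u + w) = a *: l u + l w.

Lemma lin0 n W (l : 'rV[R]_n -> W) : lin l -> l 0 = 0.
Proof.
move=> ll; have := ll 1 0 0; rewrite !scale1r addr0 => /eqP.
by rewrite -subr_eq0 opprD addNKr oppr_eq0 => /eqP.
Qed.

Lemma linD n W (l : 'rV[R]_n -> W) u w : lin l -> l (u + w) = l u + l w.
Proof. by move=> ll; have := ll 1 u w; rewrite !scale1r. Qed.

Lemma linZ n W (l : 'rV[R]_n -> W) a u : lin l -> l (a *: u) = a *: l u.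
Proof. by move=> ll; have := ll a u 0; rewrite (lin0 ll) !addr0. Qed.

Lemma linN n W (l : 'rV[R]_n -> W) u : lin l -> l (- u) = - l u.
Proof. by move=> ll; rewrite -scaleN1r linZ// scaleN1r. Qed.

(** Expansion on the standard basis reduces the calculus of linear and bilinear
maps of row vectors to that of scalar coordinates. *)
Lemma lin_expand n W (l : 'rV[R]_n -> W) u : lin l ->
  l u = \sum_(i < n) u 0 i *: l (delta_mx 0 i).
Proof.
move=> ll; rewrite [in LHS](row_sum_delta u).
elim/big_ind2 : _ => [|a b c d <- <-|i _]; first exact: lin0.
  exact: linD.
exact: linZ.
Qed.

Lemma hasD_coord n V (f : V -> 'rV[R]_n) x v d i :
  hasD f x v d -> hasD (fun y => f y 0 i) x v (d 0 i).
Proof.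
move=> [Df <-]; split.
  apply: (@differentiable_comp _ _ _ _ f (fun M : 'rV_n => M 0 i)) => //.
  exact: differentiable_coord.
by rewrite derive_mx ?mxE//; exact: diff_derivable.
Qed.

Lemma hasD_lin n V W (l : 'rV[R]_n -> W) (f : V -> 'rV[R]_n) x v d : lin l ->
  hasD f x v d -> hasD (fun y => l (f y)) x v (l d).
Proof.
move=> ll hf; under [X in hasD X]eq_fun do rewrite lin_expand//.
rewrite (lin_expand _ ll); apply: hasD_sum => i.
apply: hasD_eq.
  by apply: hasDZ; [exact: hasD_coord hf | exact: hasD_cst].
by rewrite scaler0 addr0.
Qed.

Definition bil m n W (B : 'rV[R]_m -> 'rV[R]_n -> W) :=
  (forall w, lin (fun u => B u w)) /\ (forall u, lin (B u)).

Lemma bil_expand m n W (B : 'rV[R]_m -> 'rV[R]_n -> W) u w : bil B ->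
  B u w = \sum_(i < m) \sum_(j < n)
    (u 0 i * w 0 j) *: B (delta_mx 0 i) (delta_mx 0 j).
Proof.
move=> [Bl Br]; rewrite (lin_expand _ (Bl w)); apply: eq_bigr => i _.
by rewrite (lin_expand _ (Br _)) scaler_sumr; under eq_bigr do rewrite scalerA.
Qed.

Lemma hasD_bil m n V W (B : 'rV[R]_m -> 'rV[R]_n -> W)
    (f : V -> 'rV[R]_m) (g : V -> 'rV[R]_n) x v df dg : bil B ->
  hasD f x v df -> hasD g x v dg ->
  hasD (fun y => B (f y) (g y)) x v (B df (g x) + B (f x) dg).
Proof.
move=> bB hf hg; under [X in hasD X]eq_fun do rewrite (bil_expand _ _ bB).
rewrite (bil_expand df _ bB) (bil_expand (f x) _ bB) -big_split.
apply: hasD_sum => i; rewrite -big_split; apply: hasD_sum => j.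
apply: hasD_eq.
  apply: hasDZ; last exact: hasD_cst.
  by apply: hasDM; [exact: hasD_coord hf | exact: hasD_coord hg].
by rewrite scaler0 addr0 scalerDl.
Qed.

(** This covers tensor fields: the bilinear map itself may depend on the point, as
the metric and the Christoffel symbols do. *)
Lemma differentiable_bil m n V W (B : V -> 'rV[R]_m -> 'rV[R]_n -> W)
    (f : V -> 'rV[R]_m) (g : V -> 'rV[R]_n) x :
  (forall y, bil (B y)) -> (forall u w, differentiable (fun y => B y u w) x) ->
  differentiable f x -> differentiable g x ->
  differentiable (fun y => B y (f y) (g y)) x.
Proof.
move=> bB dB df dg; rewrite (_ : (fun y => _) = fun y =>
    \sum_(i < m) \sum_(j < n)
    (f y 0 i * g y 0 j) *: B y (delta_mx 0 i) (delta_mx 0 j)); last first.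
  by apply/funext => y; rewrite (bil_expand _ _ (bB y)).
apply: (@hasD_diff _ _ _ _ x 0); apply: hasD_sum => i; apply: hasD_sum => j.
apply: hasDZ; last exact: diff_hasD.
by apply: hasDM; apply: hasD_coord; exact: diff_hasD.
Qed.

End row_calculus.

Section smoothness.
Context {R : realType}.
Implicit Types (V W : normedModType R).

Lemma Ck_ext k V W (U : set V) (f g : V -> W) : open U ->
  (forall x, U x -> f x = g x) -> Ck k U f -> Ck k U g.
Proof.
move=> oU; elim: k f g => [|k IH] f g fg /=.
  move=> h x Ux; have n := near_open oU Ux fg.
  have := h x Ux; rewrite /prop_for /continuous_at -(fg x Ux).
  by move=> hf; apply: cvg_trans hf; apply: near_eq_cvg.
move=> [df Df]; split=> [x Ux|v].
  exact: near_differentiable (near_open oU Ux fg) (df x Ux).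
apply: (IH _ _ _ (Df v)) => x Ux; apply: near_eq_derive.
exact: near_open oU Ux fg.
Qed.

Lemma Ck_pred k V W (U : set V) (f : V -> W) : Ck k.+1 U f -> Ck k U f.
Proof.
elim: k f => [|k IH] f [df Df].
  by move=> x /df; exact: differentiable_continuous.
by split=> // v; apply: IH.
Qed.

Lemma Ck_subset k V W (U U' : set V) (f : V -> W) :
  U' `<=` U -> Ck k U f -> Ck k U' f.
Proof.
move=> s; elim: k f => [|k IH] f; first by move=> h x /s; apply: h.
by move=> [df Df]; split=> [x /s Ux|v]; [exact: df|exact: IH (Df v)].
Qed.

(** Induction step for smoothness: it suffices to know the directional derivatives
on U itself. *)
Lemma Ck_succ k V W (U : set V) (f : V -> W) (df : V -> V -> W) : open U ->
  (forall x v, U x -> hasD f x v (df v x)) -> (forall v, Ck k U (df v)) ->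
  Ck k.+1 U f.
Proof.
move=> oU Df Cdf; split=> [x Ux|v]; first exact: hasD_diff (Df x 0 Ux).
by apply: Ck_ext (Cdf v) => // x Ux; exact/esym/hasD_val/Df.
Qed.

Lemma Ck_cst k V W (U : set V) (a : W) : open U -> Ck k U (fun _ => a).
Proof.
move=> oU; elim: k a => [|k IH] a; first by move=> x _; exact: cvg_cst.
by apply: (Ck_succ (df := fun _ _ => 0)) => // *; exact: hasD_cst.
Qed.

Lemma CkD k V W (U : set V) (f g : V -> W) : open U ->
  Ck k U f -> Ck k U g -> Ck k U (fun x => f x + g x).
Proof.
move=> oU; elim: k f g => [|k IH] f g /=.
  by move=> cf cg x Ux; apply: cvgD; [exact: cf|exact: cg].
move=> [df Df] [dg Dg]; split=> [x Ux|v].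
  by apply: differentiableD; [exact: df|exact: dg].
apply: Ck_ext (IH _ _ (Df v) (Dg v)) => // x Ux.
by apply/esym/hasD_val/hasDD; apply: diff_hasD; [exact: df|exact: dg].
Qed.

Lemma CkZ k V W (U : set V) (a : V -> R) (f : V -> W) : open U ->
  Ck k U a -> Ck k U f -> Ck k U (fun x => a x *: f x).
Proof.
move=> oU; elim: k a f => [|k IH] a f.
  by move=> ca cf x Ux; apply: cvgZ; [exact: ca|exact: cf].
move=> Ca Cf; have [da Da] := Ca; have [df Df] := Cf; split=> [x Ux|v].
  apply: (@hasD_diff _ _ _ _ x 0).
  by apply: hasDZ; apply: diff_hasD; [exact: da|exact: df].
have := CkD oU (IH _ _ (Da v) (Ck_pred Cf)) (IH _ _ (Ck_pred Ca) (Df v)).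
apply: Ck_ext => // x Ux.
by apply/esym/hasD_val/hasDZ; apply: diff_hasD; [exact: da|exact: df].
Qed.

(** By the chain rule, the derivative of h o f is the product of that of f with
h' o f, to which the induction hypothesis applies. *)
Lemma Ck_comp k V W (U : set V) (J : set R) (f : V -> R) (h : R -> W) :
  open U -> (forall x, U x -> J (f x)) -> Ck k U f -> Ck k J h ->
  Ck k U (fun x => h (f x)).
Proof.
move=> oU UJ; elim: k h => [|k IH] h Cf Ch.
  move=> x Ux; apply: (@continuous_comp _ _ _ f h); first exact: Cf.
  by apply: Ch; exact: UJ.
have [df Df] := Cf; have [dh Dh] := Ch.
have H x v : U x -> hasD (fun x => h (f x)) x v ('D_v f x *: 'D_1 h (f x)).
  by move=> Ux; apply: hasD_comp; apply: diff_hasD; [exact: df|exact/dh/UJ].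
split=> [x Ux|v]; first exact: hasD_diff (H x 0 Ux).
have := CkZ oU (Df v) (IH _ (Ck_pred Cf) (Dh 1)).
by apply: Ck_ext => // x Ux; exact/esym/hasD_val/H.
Qed.

Lemma Ck_lin k n V W (U : set V) (l : 'rV[R]_n -> W) (f : V -> 'rV[R]_n) :
  open U -> lin l -> Ck k U f -> Ck k U (fun x => l (f x)).
Proof.
move=> oU ll; elim: k f => [|k IH] f.
  move=> Cf x Ux; apply: (@continuous_comp _ _ _ f l); first exact: Cf.
  apply: differentiable_continuous.
  by apply: (@hasD_diff _ _ _ _ _ 0); apply: hasD_lin (hasD_id _ _).
move=> [df Df].
have H x v : U x -> hasD (fun x => l (f x)) x v (l ('D_v f x)).
  by move=> Ux; apply: hasD_lin => //; apply: diff_hasD; exact: df.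
split=> [x Ux|v]; first exact: hasD_diff (H x 0 Ux).
by have := IH _ (Df v); apply: Ck_ext => // x Ux; exact/esym/hasD_val/H.
Qed.

Lemma Ck_coord k n (U : set 'rV[R]_n) i : open U ->
  Ck k U (fun u : 'rV[R]_n => u 0 i).
Proof.
move=> oU; case: k => [|k]; first by move=> x _; exact: coord_continuous.
apply: (Ck_succ (df := fun v _ : 'rV[R]_n => v 0 i)) => // [x v _|v]; last exact: Ck_cst.
exact: hasD_coord (hasD_id _ _).
Qed.

Lemma hasD_real W (h : R -> W) (x v : R) dh :
  is_derive x 1 h dh -> hasD h x v (v *: dh).
Proof.
move=> [dx <-]; apply: (hasD_comp (f := fun y => y)); first exact: hasD_id.
by apply: diff_hasD; exact/derivable1_diffP.
Qed.

(** Sine and cosine have to be treated together, each being the derivative of the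
other up to sign. *)
Lemma Ck_sin_cos k : Ck k setT (@sin R) /\ Ck k setT (@cos R).
Proof.
elim: k => [|k [IHs IHc]].
  by split=> x _; [exact: continuous_sin | exact: continuous_cos].
have ds (v x : R) : hasD sin x v (v *: cos x) by exact: hasD_real.
have dc (v x : R) : hasD cos x v (v *: - sin x) by exact: hasD_real.
have oT : open (setT : set R) by exact: openT.
split; [apply: (Ck_succ (df := fun v x : R => v *: cos x)) => // v |
        apply: (Ck_succ (df := fun v x : R => (- v) *: sin x)) => // [x v _|v]].
- by apply: CkZ => //; exact: Ck_cst.
- by apply: hasD_eq (dc v x) _; rewrite scalerN scaleNr.
- by apply: CkZ => //; exact: Ck_cst.
Qed.

(** All exponents are treated at once, since differentiation lowers the exponent. *)
Lemma Ck_powR k (a : R) :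
  Ck k ([set x : R | 0 < x] : set R) (fun x : R => x `^ a).
Proof.
set P := (X in Ck _ X _); have oP : open P by exact: open_gt.
have D (b v x : R) : 0 < x ->
    hasD (fun x : R => x `^ b) x v (v *: (b * x `^ (b - 1))).
  by move=> x0; apply: hasD_real; exact: is_derive1_powR.
elim: k a => [|k IH] a.
  by move=> x x0; apply: differentiable_continuous; exact: hasD_diff (D a 0 x x0).
apply: (Ck_succ (df := fun v x : R => (v * a) *: x `^ (a - 1))) => // [x v x0|v].
  by apply: hasD_eq (D a v x x0) _; rewrite -scalerA.
by apply: CkZ => //; exact: Ck_cst.
Qed.

End smoothness.

Section chain_rule.
Context {R : realType}.
Implicit Types (V W : normedModType R).

Lemma hasD_chain V V' W (f : V -> V') (h : V' -> W) x v df :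
  hasD f x v df -> differentiable h (f x) ->
  hasD (fun y => h (f y)) x v ('D_df h (f x)).
Proof.
move=> [Df <-] Dh.
have D : differentiable (h \o f) x by exact: differentiable_comp.
by split; [exact: D | rewrite (deriveE _ D) diff_comp//= -!deriveE].
Qed.

Lemma derive_dirP V W (f : V -> W) x a v w : differentiable f x ->
  'D_(a *: v + w) f x = a *: 'D_v f x + 'D_w f x.
Proof. by move=> Df; rewrite !deriveE// linearP. Qed.

Lemma is_derive_line V W (f : V -> W) (p v : V) (s : R) :
  differentiable f (p + s *: v) ->
  is_derive s 1 (fun s => f (p + s *: v)) ('D_v f (p + s *: v)).
Proof.
move=> Df.
have hl : hasD (fun s : R => p + s *: v) s 1 v.
  apply: hasD_eq.
    by apply: hasDD; [exact: hasD_cst|apply: hasDZ; [exact: hasD_id|exact: hasD_cst]].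
  by rewrite scaler0 scale1r add0r addr0.
have [D E] := hasD_chain hl Df.
by rewrite -E; split => //; exact: diff_derivable.
Qed.

(** The mean value theorem applied first along v to the difference of f on two
parallel segments, then along w to the derivative so obtained. *)
Lemma second_difference V (f : V -> R) (U : set V) (x v w : V) (h : R) :
  0 < h -> Ck 2 U f ->
  (forall s t, s \in `[0, h] -> t \in `[0, h] -> U (x + s *: v + t *: w)) ->
  exists s t, [/\ s \in `[0, h], t \in `[0, h] &
    f (x + h *: v + h *: w) - f (x + h *: v) - (f (x + h *: w) - f x) =
    'D_w ('D_v f) (x + s *: v + t *: w) * h * h].
Proof.
move=> h0 [df Df] Ubox.
have h0i : 0 \in `[0, h] by rewrite in_itv /= lexx ltW.
have hi : h \in `[0, h] by rewrite in_itv /= lexx ltW.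
have sub s : s \in `]0, h[ -> s \in `[0, h].
  by rewrite !in_itv /= => /andP[? ?]; rewrite !ltW.
have Uv s : s \in `[0, h] -> U (x + s *: v).
  by move=> /Ubox/(_ h0i); rewrite scale0r addr0.
pose phi s := f (x + h *: w + s *: v) - f (x + s *: v).
have dphi s : s \in `[0, h] -> is_derive s 1 phi
    ('D_v f (x + h *: w + s *: v) - 'D_v f (x + s *: v)).
  move=> si; apply: is_deriveB; apply: is_derive_line; apply: df.
    by rewrite addrAC; apply: Ubox.
  exact: Uv.
have cphi : {within `[0, h], continuous phi}.
  by apply: derivable_within_continuous => s /dphi[].
have [s si Es] := MVT h0 (fun s si => dphi s (sub s si)) cphi.
pose psi t := 'D_v f (x + s *: v + t *: w).
have dpsi t : t \in `[0, h] ->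
    is_derive t 1 psi ('D_w ('D_v f) (x + s *: v + t *: w)).
  move=> ti; apply: is_derive_line; apply: (Df v).1.
  by apply: Ubox => //; exact: sub.
have cpsi : {within `[0, h], continuous psi}.
  by apply: derivable_within_continuous => t /dpsi[].
have [t ti Et] := MVT h0 (fun t ti => dpsi t (sub t ti)) cpsi.
exists s, t; split; [exact: sub|exact: sub|].
move: Es Et; rewrite /phi /psi !scale0r !addr0 subr0 => Es Et.
by rewrite -Et [x + s *: v + _]addrAC -Es [x + h *: w + _]addrAC opprB.
Qed.

(** Two continuous functions that take a common value, possibly at different points,
in every neighbourhood of x agree at x. *)
Lemma eq_of_nearby_values V (A B : V -> R) x :
  {for x, continuous A} -> {for x, continuous B} ->
  (forall d, 0 < d -> exists p q, [/\ ball x d p, ball x d q & A p = B q]) ->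
  A x = B x.
Proof.
move=> cA cB H; apply/eqP; rewrite -subr_eq0 -normr_le0.
apply/ler_addgt0Pr => e e0; rewrite add0r.
have e2 : 0 < e / 2 by rewrite divr_gt0.
have [a /= a0 Ha] := proj1 (nbhs_ballP _ _) (proj1 (cvgrPdist_lt _ _) cA _ e2).
have [b /= b0 Hb] := proj1 (nbhs_ballP _ _) (proj1 (cvgrPdist_lt _ _) cB _ e2).
have ab0 : 0 < Num.min a b by rewrite lt_min a0.
have [p [q [xp xq E]]] := H _ ab0.
have hp : `|A x - A p| < e / 2.
  by apply: Ha; apply: le_ball xp; rewrite ge_min lexx.
have hq : `|B x - B q| < e / 2.
  by apply: Hb; apply: le_ball xq; rewrite ge_min lexx orbT.
apply: ltW; rewrite [e]splitr.
rewrite (_ : A x - B x = (A x - A p) - (B x - B q)); last by rewrite E; ring.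
by apply: le_lt_trans (ler_normB _ _) _; rewrite ltrD.
Qed.

(** Symmetry of second derivatives: the second difference of f over a small
parallelogram is symmetric in v and w, and it is a value of either mixed
derivative near x, times the square of the step. *)
Lemma mixed_derive V (f : V -> R) (U : set V) (x v w : V) :
  open U -> U x -> Ck 2 U f -> 'D_w ('D_v f) x = 'D_v ('D_w f) x.
Proof.
move=> oU Ux C2.
have c a b : {for x, continuous ('D_a ('D_b f))}.
  by have [_ /(_ b)[_ /(_ a) cc]] := C2; exact: cc.
apply: (eq_of_nearby_values (c w v) (c v w)) => d0 d0_gt0.
have [d1 /= d1_gt0 Ud] : exists2 d : R, 0 < d & forall y, ball x d y -> U y.
  exact/nbhs_ballP/open_nbhs_nbhs.
pose d := Num.min d0 d1.
have d_gt0 : 0 < d by rewrite lt_min d0_gt0.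
pose N := 1 + `|v| + `|w|.
have N0 : 0 < N by rewrite /N -addrA ltr_pwDl// addr_ge0.
(* with this step the parallelogram stays in the ball of radius d *)
pose h := d / (2 * N).
have h0 : 0 < h by rewrite divr_gt0// mulr_gt0.
have box v' w' s t : `|v'| + `|w'| = `|v| + `|w| -> s \in `[0, h] ->
    t \in `[0, h] -> ball x d (x + s *: v' + t *: w').
  move=> E; rewrite !in_itv /= => /andP[s0 sh] /andP[t0 th].
  rewrite -ball_normE /= opprD addrA opprD addrA subrr sub0r.
  apply: le_lt_trans (ler_normB _ _) _; rewrite normrN !normrZ !ger0_norm//.
  apply: (@le_lt_trans _ _ (h * (`|v'| + `|w'|))).
    by rewrite mulrDr lerD// ler_wpM2r.
  rewrite E; apply: (@le_lt_trans _ _ (h * N)).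
    by rewrite ler_wpM2l 1?ltW// /N -addrA; lra.
  rewrite /h invfM mulrA -mulrA mulVf ?gt_eqF// mulr1; lra.
have sub0 y : ball x d y -> ball x d0 y by apply: le_ball; rewrite ge_min lexx.
have sub1 y : ball x d y -> U y.
  by move=> xy; apply: Ud; apply: le_ball xy; rewrite ge_min lexx orbT.
have [s [t [si ti E1]]] := second_difference h0 C2
  (fun s t si ti => sub1 _ (box v w s t erefl si ti)).
have [s' [t' [si' ti' E2]]] := second_difference h0 C2
  (fun s t si ti => sub1 _ (box w v s t (addrC _ _) si ti)).
exists (x + s *: v + t *: w), (x + s' *: w + t' *: v); split.
- exact/sub0/box.
- by apply/sub0/box => //; rewrite addrC.
have hn : h != 0 by rewrite gt_eqF.
apply: (mulIf hn); apply: (mulIf hn); apply: (etrans (esym E1)).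
apply: (etrans _ E2); rewrite [x + h *: w + _]addrAC; ring.
Qed.

Lemma mixed_derive_row n V (f : V -> 'rV[R]_n) (U : set V) (x v w : V) :
  open U -> U x -> Ck 2 U f -> 'D_w ('D_v f) x = 'D_v ('D_w f) x.
Proof.
move=> oU Ux C2; have [df Df] := C2.
have coord i a b : ('D_a ('D_b f) x) 0 i = 'D_a ('D_b (fun y => f y 0 i)) x.
  have [d2 _] := Df b.
  rewrite -(hasD_val (hasD_coord i (diff_hasD a (d2 x Ux)))).
  apply: near_eq_derive; apply: near_open oU Ux _ => y Uy.
  by apply/esym/hasD_val/hasD_coord/diff_hasD/df.
apply/rowP => i; apply: (etrans (coord i w v)); apply: (etrans _ (esym (coord i v w))).
apply: (mixed_derive v w oU Ux).
apply: (Ck_lin (l := fun u : 'rV[R]_n => u 0 i)) => // a u u'.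
by rewrite !mxE.
Qed.

Lemma derive0_constant (f : R -> R) (J : set R) : is_interval J ->
  (forall s, J s -> hasD f s 1 0) -> forall s t, J s -> J t -> f s = f t.
Proof.
move=> Ji Df; suff le s t : s <= t -> J s -> J t -> f s = f t.
  by move=> s t Js Jt; case: (leP s t) => [/le|/ltW/le H]; [exact|exact/esym/H].
move=> st Js Jt.
have Jst u : u \in `[s, t] -> J u by rewrite in_itv /=; exact: Ji.
have D u : u \in `[s, t] -> is_derive u 1 f 0.
  by move=> /Jst/Df[Du Eu]; split; [exact: diff_derivable|].
have C : {within `[s, t], continuous f}.
  by apply: derivable_within_continuous => u /D[].
have Do u : u \in `]s, t[ -> is_derive u 1 f ((fun=> 0) u).
  by move=> ui; apply: D; move: ui; rewrite !in_itv /= => /andP[? ?]; rewrite !ltW.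
have [c _ E] := MVT_segment st Do C.
by apply/esym/eqP; rewrite -subr_eq0 E mul0r.
Qed.

(** This is how vectors are normalized to unit length. *)
Lemma powR_invsqrt (x : R) : 0 < x -> (x `^ (- 2^-1)) ^+ 2 * x = 1.
Proof.
move=> x0; rewrite -powR_mulrn ?powR_ge0// -powRrM mulNr mulVf//.
by rewrite powRN powRr1 ?ltW// mulVf// gt_eqF.
Qed.

End chain_rule.

(** * Quaternionic algebra of the Hopf map *)

Section quaternionic_algebra.
Context {R : realType}.
Notation R4 := 'rV[R]_4.
Notation R3 := 'rV[R]_3.

Lemma row4P (u v : R4) : u 0 0 = v 0 0 -> u 0 1 = v 0 1 ->
  u 0 2 = v 0 2 -> u 0 3 = v 0 3 -> u = v.
Proof.
move=> h0 h1 h2 h3; apply/rowP => -[[|[|[|[|//]]]] Hi].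
- by rewrite (_ : Ordinal Hi = 0)//; exact/val_inj.
- by rewrite (_ : Ordinal Hi = 1)//; exact/val_inj.
- by rewrite (_ : Ordinal Hi = 2)//; exact/val_inj.
- by rewrite (_ : Ordinal Hi = 3)//; exact/val_inj.
Qed.

Lemma row3P (u v : R3) : u 0 0 = v 0 0 -> u 0 1 = v 0 1 ->
  u 0 2 = v 0 2 -> u = v.
Proof.
move=> h0 h1 h2; apply/rowP => -[[|[|[|//]]] Hi].
- by rewrite (_ : Ordinal Hi = 0)//; exact/val_inj.
- by rewrite (_ : Ordinal Hi = 1)//; exact/val_inj.
- by rewrite (_ : Ordinal Hi = 2)//; exact/val_inj.
Qed.

Lemma dot4E (u v : R4) : dot u v =
  u 0 0 * v 0 0 + u 0 1 * v 0 1 + u 0 2 * v 0 2 + u 0 3 * v 0 3.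
Proof.
rewrite /dot !big_ord_recl big_ord0 addr0 !addrA.
by congr (_ + _ + _ + _); congr (u 0 _ * v 0 _); exact/val_inj.
Qed.

Lemma dot3E (u v : R3) : dot u v =
  u 0 0 * v 0 0 + u 0 1 * v 0 1 + u 0 2 * v 0 2.
Proof.
rewrite /dot !big_ord_recl big_ord0 addr0 !addrA.
by congr (_ + _ + _); congr (u 0 _ * v 0 _); exact/val_inj.
Qed.

Definition vec4 (a b c d : R) : R4 := \row_j [:: a; b; c; d]`_j.
Definition vec3 (a b c : R) : R3 := \row_j [:: a; b; c]`_j.

Lemma vec4E a b c d : (vec4 a b c d 0 0 = a) * (vec4 a b c d 0 1 = b) *
  (vec4 a b c d 0 2 = c) * (vec4 a b c d 0 3 = d).
Proof. by rewrite /vec4 !mxE. Qed.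

Lemma vec3E a b c : (vec3 a b c 0 0 = a) * (vec3 a b c 0 1 = b) *
  (vec3 a b c 0 2 = c).
Proof. by rewrite /vec3 !mxE. Qed.

(** Multiplication by i on R^4 = C^2; it carries p to the direction of the Hopf
fibre through p. *)
Definition iJ (v : R4) : R4 := vec4 (- v 0 1) (v 0 0) (- v 0 3) (v 0 2).

(** The symmetric bilinear map polarizing twice the Hopf map, so that
[hopfb p] is the differential of the Hopf map at p. *)
Definition hopfb (p v : R4) : R3 := vec3
  (p 0 0 * v 0 2 + v 0 0 * p 0 2 + p 0 1 * v 0 3 + v 0 1 * p 0 3)
  (p 0 1 * v 0 2 + v 0 1 * p 0 2 - p 0 0 * v 0 3 - v 0 0 * p 0 3)
  (p 0 0 * v 0 0 + p 0 1 * v 0 1 - p 0 2 * v 0 2 - p 0 3 * v 0 3).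

(** The adjoint of [hopfb p].  On the unit sphere the differential of the Hopf map
is isometric on the orthogonal complement of ip, so this adjoint is the
horizontal lift at p.  In quaternions it is y |-> - i p y. *)
Definition lift (y : R3) (p : R4) : R4 := vec4
  (y 0 0 * p 0 2 - y 0 1 * p 0 3 + y 0 2 * p 0 0)
  (y 0 0 * p 0 3 + y 0 1 * p 0 2 + y 0 2 * p 0 1)
  (y 0 0 * p 0 0 + y 0 1 * p 0 1 - y 0 2 * p 0 2)
  (y 0 0 * p 0 1 - y 0 1 * p 0 0 - y 0 2 * p 0 3).

Definition cross (u v : R3) : R3 := vec3
  (u 0 1 * v 0 2 - u 0 2 * v 0 1)
  (u 0 2 * v 0 0 - u 0 0 * v 0 2)
  (u 0 0 * v 0 1 - u 0 1 * v 0 0).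

Definition coordE := (dot4E, dot3E, vec4E, vec3E).

End quaternionic_algebra.

Ltac row4 := apply: row4P; rewrite /iJ /lift /hopfb /cross ?coordE ?mxE /= ?coordE ?mxE /=; ring.
Ltac row3 := apply: row3P; rewrite /iJ /lift /hopfb /cross ?coordE ?mxE /= ?coordE ?mxE /=; ring.
Ltac dots := rewrite /iJ /lift /hopfb /cross ?coordE ?mxE /= ?coordE ?mxE /=; ring.

Section quaternionic_algebra2.
Context {R : realType}.
Notation R4 := 'rV[R]_4.
Notation R3 := 'rV[R]_3.
Implicit Types (p v w : R4) (y z : R3).

Lemma iJ_lin : lin (@iJ R).
Proof. by move=> a u w; row4. Qed.
Lemma hopfb_bil : bil (@hopfb R).
Proof. by split=> p a u w; row3. Qed.
Lemma lift_bil : bil (@lift R).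
Proof. by split=> p a u w; row4. Qed.
Lemma cross_bil : bil (@cross R).
Proof. by split=> p a u w; row3. Qed.
Lemma dot_bil n : bil (@dot R n).
Proof.
split=> p a u w; rewrite /dot scaler_sumr -big_split;
  apply: eq_bigr => i _; rewrite !mxE.
  by rewrite mulrDl -mulrA.
by rewrite mulrDr mulrCA.
Qed.

Lemma dotC n (u v : 'rV[R]_n) : dot u v = dot v u.
Proof. by apply: eq_bigr => i _; rewrite mulrC. Qed.

Lemma iJK v : iJ (iJ v) = - v.
Proof. row4. Qed.
Lemma dot_iJl v w : dot (iJ v) w = - dot v (iJ w).
Proof. dots. Qed.
Lemma dot_iJ v : dot v (iJ v) = 0.
Proof. dots. Qed.
Lemma dot_iJiJ v w : dot (iJ v) (iJ w) = dot v w.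
Proof. dots. Qed.
Lemma hopfE p : hopf p = 2^-1 *: hopfb p p.
Proof.
by rewrite /hopf; congr (_ *: _); apply: row3P; rewrite /hopfb ?coordE ?mxE /=; ring.
Qed.
(** The differential of the Hopf map followed by its adjoint is, on the unit sphere,
the projection along the fibre. *)
Lemma lift_hopfb p v : lift (hopfb p v) p = dot p p *: v - dot v (iJ p) *: iJ p.
Proof. row4. Qed.
Lemma hopfb_lift y p : hopfb p (lift y p) = dot p p *: y.
Proof. row3. Qed.
Lemma hopfb_iJ p : hopfb p (iJ p) = 0.
Proof. row3. Qed.
(** The Clifford relation: in quaternions - i (- i p y) y = |y|^2 p for y
imaginary. *)
Lemma lift_lift y p : lift y (lift y p) = dot y y *: p.
Proof. row4. Qed.
Lemma lift_iJ y p : lift y (iJ p) = iJ (lift y p).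
Proof. row4. Qed.
Lemma dot_lift y z p : dot (lift y p) (lift z p) = dot p p * dot y z.
Proof. dots. Qed.
Lemma dot_lift_adj y p v : dot (lift y p) v = dot y (hopfb p v).
Proof. dots. Qed.
(** Rotating a horizontal lift by i corresponds to rotating downstairs by a right
angle: on the unit sphere, if y is tangent to the base at hopf p, the last term
vanishes and the lift of the cross product of y with 2 hopf p remains. *)
Lemma iJ_lift y p : dot p p *: iJ (lift y p) =
  lift (cross y (hopfb p p)) p + dot y (hopfb p p) *: iJ p.
Proof. row4. Qed.
(** Polynomial form of the expansion of w in the basis e, f, e x f, valid without
any normalization. *)
Lemma cross_frame (e f w : R3) :
  (dot e e * dot f f - dot e f ^+ 2) *: w =
  dot w (cross e f) *: cross e f +
  (dot w e * dot f f - dot w f * dot e f) *: e +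
  (dot w f * dot e e - dot w e * dot e f) *: f.
Proof. row3. Qed.
Lemma dot_cross e f : @dot R 3 (cross e f) (cross e f) =
  dot e e * dot f f - dot e f ^+ 2.
Proof. dots. Qed.
End quaternionic_algebra2.

(** * The Berger metric *)

Section berger.
Context {R : realType}.
Notation R4 := 'rV[R]_4.
Notation R3 := 'rV[R]_3.
Implicit Types (p v w x y z : R4).

Lemma dotDl n (u v w : 'rV[R]_n) : dot (u + v) w = dot u w + dot v w.
Proof. exact: linD ((dot_bil n).1 w). Qed.
Lemma dotDr n (u v w : 'rV[R]_n) : dot w (u + v) = dot w u + dot w v.
Proof. exact: linD ((dot_bil n).2 w). Qed.
Lemma dotZl n a (u w : 'rV[R]_n) : dot (a *: u) w = a * dot u w.
Proof. exact: linZ ((dot_bil n).1 w). Qed.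
Lemma dotZr n a (u w : 'rV[R]_n) : dot w (a *: u) = a * dot w u.
Proof. exact: linZ ((dot_bil n).2 w). Qed.
Lemma dotNl n (u w : 'rV[R]_n) : dot (- u) w = - dot u w.
Proof. exact: linN ((dot_bil n).1 w). Qed.
Lemma dotNr n (u w : 'rV[R]_n) : dot w (- u) = - dot w u.
Proof. exact: linN ((dot_bil n).2 w). Qed.
Lemma dot0l n (w : 'rV[R]_n) : dot 0 w = 0.
Proof. exact: lin0 ((dot_bil n).1 w). Qed.
Lemma dot0r n (w : 'rV[R]_n) : dot w 0 = 0.
Proof. exact: lin0 ((dot_bil n).2 w). Qed.
Definition dotE := (dotDl, dotDr, dotZl, dotZr, dotNl, dotNr, dot0l, dot0r).

Lemma dot_eq0 n (u : 'rV[R]_n) : dot u u = 0 -> u = 0.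
Proof.
move=> /eqP; rewrite /dot psumr_eq0 => [|i _]; last by rewrite -expr2 sqr_ge0.
move=> /allP h; apply/rowP => i; have := h i (mem_index_enum i).
by rewrite mxE mulf_eq0 orbb => /eqP.
Qed.

Lemma iJD v w : iJ (v + w) = iJ v + iJ w. Proof. exact: linD iJ_lin. Qed.
Lemma iJZ a v : iJ (a *: v) = a *: iJ v. Proof. exact: linZ iJ_lin. Qed.
Lemma iJN v : iJ (- v) = - iJ v. Proof. exact: linN iJ_lin. Qed.
Lemma iJB v w : iJ (v - w) = iJ v - iJ w. Proof. by rewrite iJD iJN. Qed.
Definition iJE := (iJD, iJZ, iJN, @iJK R).

Lemma hasD_hopf p v : hasD (@hopf R) p v (hopfb p v).
Proof.
have D := @hasD_bil R _ _ _ _ _ id id p v _ _ (@hopfb_bil R) (hasD_id p v) (hasD_id p v).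
have -> : hopf = fun q : R4 => 2^-1 *: hopfb q q by apply/funext => q; exact: hopfE.
apply: hasD_eq; first by apply: hasDZ; [exact: hasD_cst|exact: D].
rewrite scale0r add0r /= (_ : hopfb v p = hopfb p v); last by row3.
by rewrite -mulr2n -[hopfb p v *+ 2]scaler_nat scalerA mulVf ?scale1r// pnatr_eq0.
Qed.

Lemma S3_iJ p : S3 p -> dot (iJ p) (iJ p) = 1.
Proof. by rewrite dot_iJiJ. Qed.

(** The kernel of the differential of the Hopf map at p is spanned by ip. *)
Lemma verticalP p v : S3 p -> vertical p v <-> v = dot v (iJ p) *: iJ p.
Proof.
move=> Sp; rewrite /vertical /tangent (hasD_val (hasD_hopf p v)); split=> [[_ h]|->].
  have := lift_hopfb p v; rewrite h (lin0 ((@lift_bil R).1 p)) (Sp : dot p p = 1) scale1r.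
  by move=> /esym/eqP; rewrite subr_eq0 => /eqP.
by rewrite dotZr dot_iJ mulr0 (linZ _ _ ((@hopfb_bil R).2 p)) hopfb_iJ scaler0.
Qed.

Lemma vertical_iJ p : S3 p -> vertical p (iJ p).
Proof. by move=> Sp; apply/verticalP => //; rewrite S3_iJ// scale1r. Qed.

Lemma horizontalP p v : S3 p -> tangent p v -> dot v (iJ p) = 0 -> horizontal p v.
Proof.
move=> Sp Tv h; split => // w /(verticalP _ Sp) ->.
by rewrite dotZr h mulr0.
Qed.

(** The Berger metric in closed form: the round metric plus eps^2 - 1 times the
square of the fibre component. *)
Definition berger_dot (eps : R) p v w :=
  dot v w + (eps ^+ 2 - 1) * (dot v (iJ p) * dot w (iJ p)).

(** Split both vectors into their components along the fibre and orthogonal to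
it. *)
Lemma berger_metricE eps g p v w : berger_metric eps g -> S3 p ->
  tangent p v -> tangent p w -> g p v w = berger_dot eps p v w.
Proof.
move=> [_ [gC gl] gh gv ghv] Sp Tv Tw.
have J1 := S3_iJ Sp; have VJ := vertical_iJ Sp.
have hor u : tangent p u -> horizontal p (- dot u (iJ p) *: iJ p + u).
  move=> Tu; apply: horizontalP => //; rewrite /tangent ?dotE.
    by rewrite dot_iJ mulr0 add0r.
  by rewrite J1 mulr1 addNr.
have dec u : u = dot u (iJ p) *: iJ p + (- dot u (iJ p) *: iJ p + u).
  by rewrite addrA scaleNr subrr add0r.
have Hv := hor v Tv; have Hw := hor w Tw.
have gr u a u1 u2 : g p u (a *: u1 + u2) = a * g p u u1 + g p u u2.
  by rewrite gC gl !(gC p u).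
rewrite [X in g p X _]dec [X in g p _ X]dec gl !(gr _ (dot w (iJ p))) (gv _ _ _ Sp VJ VJ).
rewrite (ghv _ _ _ Sp Hv VJ) (gC _ (iJ p)) (ghv _ _ _ Sp Hw VJ) (gh _ _ _ Sp Hv Hw).
rewrite /berger_dot !dotE J1 (dotC (iJ p) w); ring.
Qed.

(** A derivative in a tangent direction only depends on the values on the sphere:
both maps agree along the normalized line t |-> (p + t v) / |p + t v|. *)
Lemma sphere_derive (W : normedModType R) (f h : R4 -> W) p v :
  S3 p -> tangent p v -> differentiable f p -> differentiable h p ->
  (forall q, S3 q -> f q = h q) -> 'D_v f p = 'D_v h p.
Proof.
move=> Sp Tv Df Dh fh.
pose k (t : R) := 1 + t * t * dot v v.
have k_gt0 t : 0 < k t.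
  have := sqr_ge0 t; rewrite expr2 => t2.
  have v2 : 0 <= dot v v by apply: sumr_ge0 => i _; rewrite -expr2 sqr_ge0.
  by rewrite /k ltr_pwDl// mulr_ge0.
(* the squared norm of p + t v is k t, as v is orthogonal to p *)
pose c (t : R) := (k t `^ (- 2^-1)) *: (p + t *: v).
have Sc t : S3 (c t).
  rewrite /S3 /c /=; have := powR_invsqrt (k_gt0 t); move: (_ `^ _) => a E.
  rewrite !dotE (dotC v p) (Tv : dot p v = 0) (Sp : dot p p = 1) -[RHS]E /k; ring.
have hk : hasD k 0 1 0.
  apply: hasD_eq.
    apply: hasDD; first exact: hasD_cst.
    apply: hasDM; last exact: hasD_cst.
    by apply: hasDM; exact: hasD_id.
  by rewrite mul0r mulr0 !(add0r, mul0r, mulr0).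
have k0 : k 0 = 1 by rewrite /k; ring.
have hc : hasD c 0 1 v.
  apply: hasD_eq.
    apply: hasDZ.
      apply: (hasD_comp (h := fun x : R => x `^ (- 2^-1)) hk).
      by apply: hasD_real; apply: is_derive1_powR; exact: k_gt0.
    apply: hasDD; first exact: hasD_cst.
    by apply: hasDZ; [exact: hasD_id|exact: hasD_cst].
  by rewrite !(scale0r, scale1r, addr0, add0r) k0 powR1 scale1r.
have c0 : c 0 = p by rewrite /c k0 powR1 scale1r scale0r addr0.
have E1 : hasD (fun t => f (c t)) 0 1 ('D_v f p).
  by have := @hasD_chain _ _ _ _ c f 0 1 v hc; rewrite c0; apply.
have E2 : hasD (fun t => h (c t)) 0 1 ('D_v h p).
  by have := @hasD_chain _ _ _ _ c h 0 1 v hc; rewrite c0; apply.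
apply: (etrans (esym (hasD_val E1))); apply: (etrans _ (hasD_val E2)).
congr (derive _ _ _).
by apply/funext => t; exact: fh.
Qed.

Lemma Ck_id k (V : normedModType R) (U : set V) : open U -> Ck k U (fun x : V => x).
Proof.
move=> oU; case: k => [|k]; first by move=> x _; exact: cvg_id.
apply: (Ck_succ (df := fun v _ : V => v)) => // [x v _|v]; first exact: hasD_id.
exact: Ck_cst.
Qed.

Lemma tangent_extension_field y : vector_field (tangent_extension y).
Proof.
split=> [k|p Sp].
  have oT : open (setT : set R4) by exact: openT.
  have C : Ck k setT (fun q : R4 => y + (- dot q y) *: q).
    apply: CkD => //; first exact: Ck_cst.
    apply: CkZ => //; last exact: Ck_id.
    apply: (Ck_lin (l := fun q : R4 => - dot q y)) => //; last exact: Ck_id.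
    by move=> a u w; rewrite !dotE opprD -mulrN.
  by apply: Ck_ext C => // q _; rewrite /tangent_extension scaleNr.
rewrite /tangent /tangent_extension -scaleNr !dotE (Sp : dot p p = 1) mulr1.
by rewrite subrr.
Qed.

Lemma hasD_dotl n (V : normedModType R) (f : V -> 'rV[R]_n) (w : 'rV[R]_n) (a b : V) d :
  hasD f a b d -> hasD (fun q => dot (f q) w) a b (dot d w).
Proof. by move=> h; exact: (hasD_lin (l := fun u => dot u w) ((dot_bil n).1 w) h). Qed.

Lemma hasD_tangent_extension y p v :
  hasD (tangent_extension y) p v (- (dot v y *: p) - dot p y *: v).
Proof.
apply: hasD_eq.
  apply: hasDB; first exact: hasD_cst.
  by apply: hasDZ (hasD_id _ _); apply: hasD_dotl; exact: hasD_id.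
by rewrite sub0r opprD.
Qed.

Lemma tangent_extensionE y p : tangent p y -> tangent_extension y p = y.
Proof. by move=> Ty; rewrite /tangent_extension (Ty : dot p y = 0) scale0r subr0. Qed.

End berger.

(** * The Levi-Civita connection *)

Section levi_civita_connection.
Context {R : realType}.
Notation R4 := 'rV[R]_4.
Implicit Types (p v w x y z : R4) (eps : R).

Lemma hasD_iJ (V : normedModType R) (f : V -> R4) (a b : V) d :
  hasD f a b d -> hasD (fun q => iJ (f q)) a b (iJ d).
Proof. by move=> h; exact: (hasD_lin (@iJ_lin R) h). Qed.

Lemma hasD_dot n (V : normedModType R) (f g : V -> 'rV[R]_n) (a b : V) df dg :
  hasD f a b df -> hasD g a b dg ->
  hasD (fun q => dot (f q) (g q)) a b (dot df (g a) + dot (f a) dg).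
Proof. by move=> hf hg; exact: (hasD_bil (dot_bil n) hf hg). Qed.

(** The horizontal part of iv; it is also the covariant derivative of the fibre
field in the direction v for the round metric. *)
Definition hor_iJ p v := iJ v + dot v (iJ p) *: p.

(** Difference between the Levi-Civita connections of the Berger metric and of the
round metric, as given by the Koszul formula. *)
Definition berger_shift eps p v w := (eps ^+ 2 - 1) *:
  (dot w (iJ p) *: hor_iJ p v + dot v (iJ p) *: hor_iJ p w).

Definition berger_gam eps p v w := dot v w *: p + berger_shift eps p v w.

Lemma berger_dotC eps p v w : berger_dot eps p v w = berger_dot eps p w v.
Proof. by rewrite /berger_dot (dotC v w) [dot v (iJ p) * _]mulrC. Qed.

(** Testing against the fibre direction kills the vertical part because eps is
nonzero; then test against the vector itself. *)
Lemma berger_dot_nondegenerate eps p v : eps != 0 -> S3 p -> tangent p v ->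
  (forall w, tangent p w -> berger_dot eps p v w = 0) -> v = 0.
Proof.
move=> e0 Sp Tv H; have hv : dot v (iJ p) = 0.
  have TJ : tangent p (iJ p) by exact: dot_iJ.
  have := H _ TJ; rewrite /berger_dot S3_iJ// mulr1 => h.
  have {}h : eps ^+ 2 * dot v (iJ p) = 0 by rewrite -[RHS]h; ring.
  by move/eqP: h; rewrite mulf_eq0 sqrf_eq0 (negbTE e0) => /eqP.
apply: dot_eq0; have := H _ Tv.
by rewrite /berger_dot hv mul0r mulr0 addr0.
Qed.

Lemma vector_field_diff (X : R4 -> R4) p : vector_field X -> differentiable X p.
Proof. by move=> [/(_ 1%N)[h _] _]; exact: h. Qed.

Lemma connection_bil (Gam : R4 -> R4 -> R4 -> R4) p : connection Gam -> bil (Gam p).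
Proof. by move=> [_ gl gr _]; split=> [w|u] a u1 u2; [exact: gl|exact: gr]. Qed.

Lemma connection_diff (Gam : R4 -> R4 -> R4 -> R4) p v w : connection Gam ->
  differentiable (fun q => Gam q v w) p.
Proof. by move=> [/(_ v w 1%N)[h _] _ _ _]; exact: h. Qed.

Lemma covd_tangent_extension (Gam : R4 -> R4 -> R4 -> R4) p v w :
  tangent p v -> tangent p w ->
  covd Gam (tangent_extension v) (tangent_extension w) p =
  Gam p v w - dot v w *: p.
Proof.
move=> Tv Tw; rewrite /covd !tangent_extensionE//.
rewrite (hasD_val (hasD_tangent_extension w p v)) (Tw : dot p w = 0) scale0r subr0.
by rewrite addrC.
Qed.

Lemma lie_bracket_tangent_extension p v w : tangent p v -> tangent p w ->
  lie_bracket (tangent_extension v) (tangent_extension w) p = 0.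
Proof.
move=> Tv Tw; rewrite /lie_bracket !tangent_extensionE//.
rewrite (hasD_val (hasD_tangent_extension w p v)).
rewrite (hasD_val (hasD_tangent_extension v p w)).
by rewrite (Tw : dot p w = 0) (Tv : dot p v = 0) !scale0r !subr0 (dotC w v) subrr.
Qed.

Lemma hasD_berger_dot_extension eps p v y z : tangent p v -> tangent p y -> tangent p z ->
  hasD (fun q => berger_dot eps q (tangent_extension y q) (tangent_extension z q)) p v
    ((eps ^+ 2 - 1) * (dot y (iJ v) * dot z (iJ p) + dot y (iJ p) * dot z (iJ v))).
Proof.
move=> Tv Ty Tz; have hy := hasD_tangent_extension y p v.
have hz := hasD_tangent_extension z p v.
have hJ := hasD_iJ (hasD_id p v).
apply: hasD_eq.
  apply: hasDD (hasD_dot hy hz) _; apply: hasDM; first exact: hasD_cst.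
  exact: hasDM (hasD_dot hy hJ) (hasD_dot hz hJ).
rewrite !tangent_extensionE// !dotE (dotC y p).
rewrite (Ty : dot p y = 0) (Tz : dot p z = 0) dot_iJ; ring.
Qed.

Lemma dot_hor_iJ p v w : tangent p w -> dot (hor_iJ p v) w = dot (iJ v) w.
Proof. by move=> Tw; rewrite /hor_iJ !dotE (Tw : dot p w = 0) mulr0 addr0. Qed.

Lemma hor_iJ_tangent p v : S3 p -> tangent p (hor_iJ p v).
Proof.
move=> Sp; rewrite /tangent /hor_iJ !dotE (Sp : dot p p = 1) mulr1.
by rewrite (dotC p) dot_iJl addNr.
Qed.

Lemma hor_iJ_iJ p v : tangent p v -> dot (hor_iJ p v) (iJ p) = 0.
Proof.
by move=> Tv; rewrite /hor_iJ !dotE dot_iJ dot_iJiJ (dotC v p) (Tv : dot p v = 0) mulr0 addr0.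
Qed.

Lemma berger_shift_tangent eps p v w : S3 p -> tangent p (berger_shift eps p v w).
Proof.
move=> Sp; rewrite /tangent /berger_shift dotZr dotDr !dotZr.
by rewrite !(hor_iJ_tangent _ Sp : dot p _ = 0) !mulr0 addr0 mulr0.
Qed.

Lemma berger_shift_iJ eps p v w : tangent p v -> tangent p w ->
  dot (berger_shift eps p v w) (iJ p) = 0.
Proof. move=> Tv Tw; rewrite /berger_shift dotZl dotDl !dotZl !hor_iJ_iJ//.
by rewrite !mulr0 addr0 mulr0. Qed.

Lemma berger_shiftC eps p v w : berger_shift eps p v w = berger_shift eps p w v.
Proof. by rewrite /berger_shift; congr (_ *: _); exact: addrC. Qed.

Lemma dot_berger_shift eps p v w z : tangent p z ->
  dot (berger_shift eps p v w) z = (eps ^+ 2 - 1) *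
    (dot w (iJ p) * dot (iJ v) z + dot v (iJ p) * dot (iJ w) z).
Proof. by move=> Tz; rewrite /berger_shift dotZl dotDl !dotZl !dot_hor_iJ. Qed.

(** Uniqueness of the Levi-Civita connection, evaluated on tangent extensions: both
the given connection and the explicit one are symmetric and metric, so their
difference is symmetric in two arguments and skew in two others. *)
Lemma levi_civitaE eps g Gam p v w : eps != 0 -> berger_metric eps g ->
  levi_civita g Gam -> S3 p -> tangent p v -> tangent p w ->
  Gam p v w = berger_gam eps p v w.
Proof.
move=> e0 Bg [conn tors metr] Sp Tv0 Tw0.
(* the covariant derivative of the tangent extension of y along x *)
pose E x y := Gam p x y - dot x y *: p.
have fld := @tangent_extension_field R.
have TE x y : tangent p x -> tangent p y -> tangent p (E x y).
  move=> Tx Ty; rewrite /E -covd_tangent_extension//.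
  by have [_ _ _] := conn; apply.
have EC x y : tangent p x -> tangent p y -> E x y = E y x.
  move=> Tx Ty; apply/eqP; rewrite -subr_eq0 /E -!covd_tangent_extension//.
  by rewrite tors// lie_bracket_tangent_extension.
have EM x y z : tangent p x -> tangent p y -> tangent p z ->
    berger_dot eps p (E x y) z + berger_dot eps p y (E x z) =
    (eps ^+ 2 - 1) * (dot y (iJ x) * dot z (iJ p) + dot y (iJ p) * dot z (iJ x)).
  move=> Tx Ty Tz; have TExy := TE _ _ Tx Ty; have TExz := TE _ _ Tx Tz.
  have h := hasD_berger_dot_extension eps Tx Ty Tz.
  rewrite -(berger_metricE Bg Sp TExy Tz) -(berger_metricE Bg Sp Ty TExz).
  have := metr _ _ _ (fld x) (fld y) (fld z) p Sp.
  rewrite !covd_tangent_extension// !tangent_extensionE// => <-.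
  rewrite -(hasD_val h); apply: sphere_derive => //; last first.
  - by move=> q Sq; exact: (berger_metricE Bg Sq ((fld y).2 q Sq) ((fld z).2 q Sq)).
  - exact: hasD_diff h.
  apply: differentiable_bil; [|..|exact: vector_field_diff|exact: vector_field_diff].
  - case: Bg => [_ [gC gl] _ _ _] q; split=> u a u1 u2; first exact: gl.
    by rewrite gC gl !(gC q u).
  - by case: Bg => [sm _ _ _ _] u u'; have [d _] := sm u u' 1%N; exact: d.
pose D x y := E x y - berger_shift eps p x y.
have TD x y : tangent p x -> tangent p y -> tangent p (D x y).
  move=> Tx Ty; rewrite /tangent /D dotDr dotNr (TE x y Tx Ty : dot p _ = 0).
  by rewrite (berger_shift_tangent _ _ _ Sp : dot p _ = 0) subr0.
have DC x y : tangent p x -> tangent p y -> D x y = D y x.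
  by move=> Tx Ty; rewrite /D EC// (berger_shiftC _ _ x).
have DM x y z : tangent p x -> tangent p y -> tangent p z ->
    berger_dot eps p (D x y) z = - berger_dot eps p (D x z) y.
  move=> Tx Ty Tz; apply/eqP; rewrite -subr_eq0 opprK.
  have := EM x y z Tx Ty Tz; rewrite (berger_dotC _ _ y) /D.
  move: (E x y) (E x z) => e1 e2; rewrite /berger_dot !(dotDl _ (- _)) !dotNl.
  rewrite !berger_shift_iJ// !dot_berger_shift//.
  rewrite (dotC (iJ x) z) (dotC (iJ x) y) (dotC (iJ y) z) (dot_iJl z y).
  move/eqP; rewrite -subr_eq0 => /eqP h; apply/eqP; rewrite -[RHS]h; ring.
suff D0 : D v w = 0.
  move/eqP: D0; rewrite /D subr_eq0 /E /berger_gam => /eqP <-.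
  by rewrite addrC subrK.
apply: (berger_dot_nondegenerate e0 Sp (TD _ _ Tv0 Tw0)) => z Tz.
(* a tensor that is symmetric in two slots and skew in two others vanishes *)
have a2 : berger_dot eps p (D v w) z = - berger_dot eps p (D v w) z.
  rewrite {1}(DM v w z Tv0 Tw0 Tz) (DC v z Tv0 Tz) (DM z v w Tz Tv0 Tw0) opprK.
  by rewrite (DC z w Tz Tw0) (DM w z v Tw0 Tz Tv0) (DC w v Tw0 Tv0).
have := a2; move/eqP; rewrite -subr_eq0 opprK -mulr2n mulrn_eq0 /= => /eqP.
exact.
Qed.

End levi_civita_connection.

(** * The curvature tensor *)

Section curvature_formula.
Context {R : realType}.
Notation R4 := 'rV[R]_4.
Implicit Types (p v w x y z : R4) (eps : R).

(** A polynomial extension of the covariant derivative of two tangent extensions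
from the sphere to the ambient space. *)
Definition covd_ext eps y z (q : R4) : R4 :=
  (eps ^+ 2 - 1) *: (dot z (iJ q) *: (iJ y - dot q y *: iJ q + dot y (iJ q) *: q) +
                     dot y (iJ q) *: (iJ z - dot q z *: iJ q + dot z (iJ q) *: q))
  - dot q z *: (y - dot q y *: q).

Definition dcovd_ext eps p x y z : R4 :=
  (eps ^+ 2 - 1) *:
   (dot z (iJ x) *: hor_iJ p y +
    dot z (iJ p) *: (dot y (iJ x) *: p + dot y (iJ p) *: x - dot x y *: iJ p) +
    (dot y (iJ x) *: hor_iJ p z +
     dot y (iJ p) *: (dot z (iJ x) *: p + dot z (iJ p) *: x - dot x z *: iJ p)))
  - dot x z *: y.

Lemma covd_extE eps g Gam y z q : eps != 0 -> berger_metric eps g ->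
  levi_civita g Gam -> S3 q ->
  covd Gam (tangent_extension y) (tangent_extension z) q = covd_ext eps y z q.
Proof.
move=> e0 Bg LC Sq; have fld := @tangent_extension_field R.
have Ty := (fld y).2 q Sq; have Tz := (fld z).2 q Sq.
rewrite /covd (levi_civitaE e0 Bg LC Sq Ty Tz).
rewrite (hasD_val (hasD_tangent_extension z q _)) /berger_gam /berger_shift /hor_iJ.
have dY : dot (tangent_extension y q) (iJ q) = dot y (iJ q).
  by rewrite /tangent_extension dotDl dotNl dotZl dot_iJ mulr0 subr0.
have dZ : dot (tangent_extension z q) (iJ q) = dot z (iJ q).
  by rewrite /tangent_extension dotDl dotNl dotZl dot_iJ mulr0 subr0.
have dYZ : dot (tangent_extension y q) (tangent_extension z q) =
    dot (tangent_extension y q) z.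
  rewrite [in X in dot _ X]/tangent_extension dotDr dotNr dotZr (dotC _ q).
  by rewrite (Ty : dot q _ = 0) mulr0 subr0.
rewrite dY dZ dYZ /covd_ext /tangent_extension !iJB !iJZ.
apply/rowP => i; rewrite !mxE; ring.
Qed.

Lemma hasD_covd_ext eps p x y z : tangent p x -> tangent p y -> tangent p z ->
  hasD (covd_ext eps y z) p x (dcovd_ext eps p x y z).
Proof.
move=> Tx Ty Tz; have hI := hasD_id p x; have hJ := hasD_iJ hI.
have hdot u := hasD_dotl u hI.
have hdotJ u := hasD_dot (hasD_cst u p x) hJ.
apply: hasD_eq.
  apply: hasDB.
    apply: hasDZ; first exact: hasD_cst.
    apply: hasDD.
      apply: hasDZ; first exact: hdotJ.
      apply: hasDD; last by apply: hasDZ; [exact: hdotJ|exact: hI].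
      apply: hasDB; first exact: hasD_cst.
      by apply: hasDZ; [exact: hdot|exact: hJ].
    apply: hasDZ; first exact: hdotJ.
    apply: hasDD; last by apply: hasDZ; [exact: hdotJ|exact: hI].
    apply: hasDB; first exact: hasD_cst.
    by apply: hasDZ; [exact: hdot|exact: hJ].
  apply: hasDZ; first exact: hdot.
  apply: hasDB; first exact: hasD_cst.
  by apply: hasDZ; [exact: hdot|exact: hI].
rewrite /= (Ty : dot p y = 0) (Tz : dot p z = 0) !dot0l /dcovd_ext /hor_iJ.
apply/rowP => i; rewrite !mxE; ring.
Qed.

(** The bracket of two tangent extensions vanishes at the base point, so the
curvature is the skew part of a second covariant derivative.  In it the inner
covariant derivative may be replaced by its polynomial form, as it is only
differentiated in tangent directions. *)
Lemma riemannE eps g Gam p x y z : eps != 0 -> berger_metric eps g ->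
  levi_civita g Gam -> S3 p -> tangent p x -> tangent p y -> tangent p z ->
  riemann Gam p x y z = dcovd_ext eps p x y z - dcovd_ext eps p y x z +
    (berger_gam eps p x (berger_shift eps p y z) - berger_gam eps p y (berger_shift eps p x z)).
Proof.
move=> e0 Bg LC Sp Tx Ty Tz; have [conn _ _] := LC.
have fld := @tangent_extension_field R.
have half u v w : tangent p u -> tangent p v -> tangent p w ->
    covd Gam (tangent_extension u)
      (covd Gam (tangent_extension v) (tangent_extension w)) p =
    dcovd_ext eps p u v w + berger_gam eps p u (berger_shift eps p v w).
  move=> Tu Tv Tw; rewrite {1}/covd tangent_extensionE//.
  have h := hasD_covd_ext eps Tu Tv Tw.
  have -> : covd Gam (tangent_extension v) (tangent_extension w) p =
      berger_shift eps p v w.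
    rewrite covd_tangent_extension// (levi_civitaE e0 Bg LC)// /berger_gam.
    by rewrite addrAC subrr add0r.
  rewrite (levi_civitaE e0 Bg LC)//; last exact: berger_shift_tangent.
  suff -> : 'D_u (covd Gam (tangent_extension v) (tangent_extension w)) p =
      dcovd_ext eps p u v w by [].
  apply: (etrans _ (hasD_val h)); apply: (sphere_derive Sp Tu).
  - have -> : covd Gam (tangent_extension v) (tangent_extension w) = fun q =>
       (- (dot (tangent_extension v q) w *: q) - dot q w *: tangent_extension v q)
       + Gam q (tangent_extension v q) (tangent_extension w q).
      apply/funext => q; rewrite /covd; congr (_ + _).
      exact: hasD_val (hasD_tangent_extension _ _ _).
    have hv := hasD_tangent_extension v p 0.
    have dG : differentiable
        (fun q => Gam q (tangent_extension v q) (tangent_extension w q)) p.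
      apply: differentiable_bil.
      - by move=> q; exact: connection_bil.
      - by move=> u' w'; exact: connection_diff.
      - exact: vector_field_diff.
      - exact: vector_field_diff.
    have hI := hasD_id p 0.
    exact: hasD_diff (hasDD (hasDB (hasDN (hasDZ (hasD_dotl w hv) hI))
      (hasDZ (hasD_dotl w hI) hv)) (diff_hasD 0 dG)).
  - exact: hasD_diff h.
  - by move=> q Sq; exact: covd_extE e0 Bg LC Sq.
rewrite /riemann /curvature !half//.
rewrite {1}/covd lie_bracket_tangent_extension//.
by rewrite derive0 (lin0 ((connection_bil p conn).1 _)) addr0 subr0 opprD addrACA.
Qed.

End curvature_formula.

(** * Frenet equations of a curve on the base sphere *)

(* From here on derivatives are handled only through the rules proved above,
   never through their definition as limits. *)
#[local] Opaque derive.

Section curve_definitions.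
Context {R : realType}.
Notation R3 := 'rV[R]_3.
Context (beta : R -> R3).

Definition vel (s : R) : R3 := 'D_1 beta s.
Definition acc (s : R) : R3 := 'D_1 vel s.
(** The factor 2 makes it a unit vector, beta having length 1/2. *)
Definition conormal (s : R) : R3 := 2 *: cross (vel s) (beta s).
Definition kap (s : R) : R := dot (acc s) (conormal s).
(** The derivative of the curvature ([hasD_kap]), in a closed form that is visibly
differentiable again. *)
Definition kap1 (s : R) : R := dot ('D_1 acc s) (conormal s).
Definition kap2 (s : R) : R := 'D_1 kap1 s.

End curve_definitions.

Section spherical_curve.
Context {R : realType}.
Notation R3 := 'rV[R]_3.
Context {J : set R} {beta : R -> R3}.
Notation vel := (vel beta).
Notation acc := (acc beta).
Notation conormal := (conormal beta).
Notation kap := (kap beta).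
Notation kap1 := (kap1 beta).
Notation kap2 := (kap2 beta).

Lemma hasD_const_open (V W : normedModType R) (f : V -> W) (U : set V) x v c d :
  open U -> U x -> (forall y, U y -> f y = c) -> hasD f x v d -> d = 0.
Proof.
move=> oU Ux fc hf; rewrite -(hasD_val hf).
apply: (@hasD_val _ _ _ _ _ v 0).
by apply: (hasD_open (f := fun=> c) oU Ux); [move=> y /fc|exact: hasD_cst].
Qed.

Hypothesis J_open : open J.
Hypothesis beta_curve : arclength_curve J beta.

Lemma hasD_beta s : J s -> hasD beta s 1 (vel s).
Proof. by case: beta_curve => /(_ 1%N)[h _] _ _ Js; exact/diff_hasD/h. Qed.

Lemma hasD_vel s : J s -> hasD vel s 1 (acc s).
Proof. by case: beta_curve => /(_ 2%N)[_ /(_ 1)[h _]] _ _ Js; exact/diff_hasD/h. Qed.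

Lemma hasD_acc s : J s -> hasD acc s 1 ('D_1 acc s).
Proof.
by case: beta_curve => /(_ 3%N)[_ /(_ 1)[_ /(_ 1)[h _]]] _ _ Js; exact/diff_hasD/h.
Qed.

Lemma differentiable_dacc s : J s -> differentiable ('D_1 acc) s.
Proof.
by case: beta_curve => /(_ 4%N)[_ /(_ 1)[_ /(_ 1)[_ /(_ 1)[h _]]]] _ _ Js; exact: h.
Qed.

Lemma dot_beta s : J s -> dot (beta s) (beta s) = 2^-1 ^+ 2.
Proof. by case: beta_curve => _ h _ /h. Qed.

Lemma dot_vel s : J s -> dot (vel s) (vel s) = 1.
Proof. by case: beta_curve => _ _ h /h; rewrite derive1E. Qed.

Lemma dot_vel_beta s : J s -> dot (vel s) (beta s) = 0.
Proof.
move=> Js; have h := hasD_dot (hasD_beta Js) (hasD_beta Js).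
have := hasD_const_open J_open Js dot_beta h.
by rewrite (dotC (beta s)) -mulr2n => /eqP; rewrite mulrn_eq0 => /eqP.
Qed.

Lemma dot_acc_vel s : J s -> dot (acc s) (vel s) = 0.
Proof.
move=> Js; have h := hasD_dot (hasD_vel Js) (hasD_vel Js).
have := hasD_const_open J_open Js dot_vel h.
by rewrite (dotC (vel s)) -mulr2n => /eqP; rewrite mulrn_eq0 => /eqP.
Qed.

Lemma dot_acc_beta s : J s -> dot (acc s) (beta s) = - 1.
Proof.
move=> Js; have h := hasD_dot (hasD_vel Js) (hasD_beta Js).
have := hasD_const_open J_open Js dot_vel_beta h.
by rewrite dot_vel// => /eqP; rewrite addr_eq0 => /eqP.
Qed.

Lemma conormalE s : conormal s = cross (vel s) (2 *: beta s).
Proof. by rewrite (linZ _ _ ((@cross_bil R).2 _)). Qed.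

Lemma dot_2beta s : J s -> dot (2 *: beta s) (2 *: beta s) = 1.
Proof. by move=> Js; rewrite dotZl dotZr dot_beta//; field. Qed.

Lemma orthonormal_expand (e f w : R3) : dot e e = 1 -> dot f f = 1 -> dot e f = 0 ->
  w = dot w (cross e f) *: cross e f + dot w e *: e + dot w f *: f.
Proof.
move=> ee ff ef; have := cross_frame e f w.
by rewrite ee ff ef !mulr0 !mulr1 expr0n !subr0 scale1r.
Qed.

(** The component - 4 beta is the curvature of the sphere itself; the rest is the
geodesic curvature. *)
Lemma accE s : J s -> acc s = kap s *: conormal s - 4 *: beta s.
Proof.
move=> Js; have f0 : dot (vel s) (2 *: beta s) = 0.
  by rewrite dotZr dot_vel_beta// mulr0.
have E := orthonormal_expand (acc s) (dot_vel Js) (dot_2beta Js) f0.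
apply: (etrans E); rewrite -conormalE /kap dotZr dot_acc_beta// dot_acc_vel//.
rewrite scale0r addr0 scalerA -scaleNr.
by have -> : 2 * -1 * 2 = - 4 :> R by ring.
Qed.

Lemma dot_conormal s : J s -> dot (conormal s) (conormal s) = 1.
Proof.
move=> Js; rewrite conormalE dot_cross dot_vel// dot_2beta// dotZr dot_vel_beta//.
by rewrite mulr0 expr0n subr0 mulr1.
Qed.

Lemma double_cross (e f : R3) :
  cross (cross e f) f = dot e f *: f - dot f f *: e.
Proof. row3. Qed.

Lemma hasD_conormal s : J s -> hasD conormal s 1 (- kap s *: vel s).
Proof.
move=> Js; apply: hasD_eq.
  apply: hasDZ; first exact: hasD_cst.
  exact: hasD_bil (@cross_bil R) (hasD_vel Js) (hasD_beta Js).
rewrite scale0r add0r.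
have -> : cross (vel s) (vel s) = 0 by row3.
have -> : cross (acc s) (beta s) = kap s *: cross (conormal s) (beta s).
  rewrite accE// (linD _ _ ((@cross_bil R).1 _)) (linN _ ((@cross_bil R).1 _)).
  rewrite !(linZ _ _ ((@cross_bil R).1 _)).
  have -> : cross (beta s) (beta s) = 0 by row3.
  by rewrite scaler0 subr0.
rewrite addr0 scalerA mulrC -scalerA -(linZ _ _ ((@cross_bil R).2 _)) conormalE double_cross.
by rewrite dotZr dot_vel_beta// dot_2beta// mulr0 scale0r scale1r sub0r scalerN scaleNr.
Qed.

(** The derivative of the conormal is tangent to the curve, hence orthogonal to the
acceleration, and contributes nothing. *)
Lemma hasD_kap s : J s -> hasD kap s 1 (kap1 s).
Proof.
move=> Js; have e : dot (acc s) (- kap s *: vel s) = 0.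
  by rewrite (dotZr _ (vel s)) (dot_acc_vel Js) mulr0.
have h := hasD_dot (hasD_acc Js) (hasD_conormal Js).
exact: (hasD_eq h (etrans (congr1 (fun x => kap1 s + x) e) (addr0 _))).
Qed.

Lemma hasD_kap1 s : J s -> hasD kap1 s 1 (kap2 s).
Proof.
move=> Js; apply: diff_hasD.
have h := hasD_dot (diff_hasD (1 : R) (differentiable_dacc Js)) (hasD_conormal Js).
exact: hasD_diff h.
Qed.

End spherical_curve.

Section adapted_frame.
Context {R : realType}.
Notation R4 := 'rV[R]_4.
Context {eps : R} {p T : R4}.
Hypotheses (Sp : S3 p) (TT : dot T T = 1) (pT : dot p T = 0) (TJp : dot T (iJ p) = 0).

Let Tp : dot T p = 0. Proof. by rewrite dotC. Qed.
Let pJT : dot p (iJ T) = 0. Proof. by rewrite dotC dot_iJl TJp oppr0. Qed.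
Let JTp : dot (iJ T) p = 0. Proof. by rewrite dotC. Qed.
Let JpT : dot (iJ p) T = 0. Proof. by rewrite dotC. Qed.
Let pp : dot p p = 1. Proof. exact: Sp. Qed.
Let TJT : dot T (iJ T) = 0. Proof. exact: dot_iJ. Qed.
Let JTT : dot (iJ T) T = 0. Proof. by rewrite dotC. Qed.
Let pJp : dot p (iJ p) = 0. Proof. exact: dot_iJ. Qed.
Let Jpp : dot (iJ p) p = 0. Proof. by rewrite dotC. Qed.
Let JTJT : dot (iJ T) (iJ T) = 1. Proof. by rewrite dot_iJiJ. Qed.
Let JpJp : dot (iJ p) (iJ p) = 1. Proof. by rewrite dot_iJiJ. Qed.
Let JTJp : dot (iJ T) (iJ p) = 0. Proof. by rewrite dot_iJiJ. Qed.
Let JpJT : dot (iJ p) (iJ T) = 0. Proof. by rewrite dotC. Qed.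
Definition frame_dots := (Tp, pJT, JTp, JpT, pp, TJT, JTT, pJp, Jpp, JTJT, JpJp,
  JTJp, JpJT, TT, pT, TJp).

Lemma frame_tangent t n v : tangent p (t *: T + n *: iJ T + v *: iJ p).
Proof. by rewrite /tangent !dotE !frame_dots !mulr0 !addr0. Qed.

Lemma berger_gam_frame a b t n v :
  berger_gam eps p (a *: T + b *: iJ p) (t *: T + n *: iJ T + v *: iJ p) =
  (a * t + b * v) *: p + (eps ^+ 2 - 1) *:
    ((v * a + b * t) *: iJ T - (b * n) *: T).
Proof.
rewrite /berger_gam /berger_shift /hor_iJ !iJE !dotE !frame_dots.
move: (iJ T) (iJ p) => N V; apply/rowP => i; rewrite !mxE; ring.
Qed.

Lemma berger_dot_frame a b a' b' :
  berger_dot eps p (a *: T + b *: iJ p) (a' *: T + b' *: iJ p) = a * a' + eps ^+ 2 * (b * b').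
Proof. rewrite /berger_dot !dotE !frame_dots; ring. Qed.

(** In particular horizontal planes have sectional curvature 4 - 3 eps^2 and vertical
ones eps^2. *)
Lemma riemann_frame g Gam a b k a' b' : eps != 0 -> berger_metric eps g ->
  levi_civita g Gam ->
  riemann Gam p (a *: T + b *: iJ p) (k *: iJ T) (a' *: T + b' *: iJ p) =
  (- k * ((4 - 3 * eps ^+ 2) * (a * a') + eps ^+ 4 * (b * b'))) *: iJ T.
Proof.
move=> e0 Bg LC; rewrite (riemannE e0 Bg LC)//.
- have -> : berger_shift eps p (k *: iJ T) (a' *: T + b' *: iJ p) =
     (- (eps ^+ 2 - 1) * k * b') *: T + 0 *: iJ T + 0 *: iJ p.
    rewrite /berger_shift /hor_iJ !iJE !dotE !frame_dots.
    move: (iJ T) (iJ p) => N V; apply/rowP => i; rewrite !mxE; ring.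
  have -> : berger_shift eps p (a *: T + b *: iJ p) (a' *: T + b' *: iJ p) =
     0 *: T + ((eps ^+ 2 - 1) * (b' * a + b * a')) *: iJ T + 0 *: iJ p.
    rewrite /berger_shift /hor_iJ !iJE !dotE !frame_dots.
    move: (iJ T) (iJ p) => N V; apply/rowP => i; rewrite !mxE; ring.
  rewrite berger_gam_frame.
  rewrite /berger_gam /berger_shift /dcovd_ext /hor_iJ !iJE !dotE !frame_dots.
  move: (iJ T) (iJ p) => N V; apply/rowP => i; rewrite !mxE; ring.
- by have := frame_tangent a 0 b; rewrite scale0r addr0.
- by have := frame_tangent 0 k 0; rewrite !scale0r addr0 add0r.
- by have := frame_tangent a' 0 b'; rewrite scale0r addr0.
Qed.

End adapted_frame.

(** * Traces with respect to a Gram matrix of two vectors *)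

Section two_by_two.
Context {R : realType}.

Lemma sum_ord2 (V : zmodType) (f : 'I_2 -> V) : \sum_i f i = f 0 + f 1.
Proof.
by rewrite !big_ord_recl big_ord0 addr0; congr (f _ + f _); exact/val_inj.
Qed.

Lemma ord2P (P : 'I_2 -> Prop) : P 0 -> P 1 -> forall i, P i.
Proof.
move=> P0 P1 [[|[|//]] h].
- by rewrite (_ : Ordinal h = 0)//; exact/val_inj.
- by rewrite (_ : Ordinal h = 1)//; exact/val_inj.
Qed.

Context {eps : R} {a b : 'I_2 -> R} {G : 'M[R]_2}.
Let D := a 0 * b 1 - a 1 * b 0.
Hypotheses (eps0 : eps != 0) (D0 : a 0 * b 1 - a 1 * b 0 != 0).
Hypothesis GE : forall i j, G i j = a i * a j + eps ^+ 2 * (b i * b j).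

(* the vectors dual to a and b *)
Let al : 'I_2 -> R := fun i => if i == 0 then b 1 / D else - b 0 / D.
Let be : 'I_2 -> R := fun i => if i == 0 then - a 1 / D else a 0 / D.

(** The inverse of a a^T + eps^2 b b^T is al al^T + eps^-2 be be^T for the basis
al, be dual to a, b. *)
Lemma gram_inverse : invmx G = \matrix_(i, j) (al i * al j + eps ^- 2 * (be i * be j)).
Proof.
set B := (X in _ = X).
have GB : G *m B = 1%:M.
  apply/matrixP; apply: ord2P; apply: ord2P;
  by rewrite !mxE sum_ord2 !mxE !GE /al /be /D /=; field; rewrite eps0 D0.
have [uG _] := mulmx1_unit GB.
by rewrite -[LHS]mulmx1 -GB mulmxA mulVmx// mul1mx.
Qed.

(** For the metric with Gram matrix G, the covectors a and eps b form an orthonormal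
pair. *)
Lemma gram_trace n (P Q1 Q2 Q : 'rV[R]_n) :
  \sum_i \sum_j invmx G i j *: ((a i * a j) *: P + (a i * b j) *: Q1 +
    (b i * a j) *: Q2 + (b i * b j) *: Q) = P + eps ^- 2 *: Q.
Proof.
rewrite gram_inverse !sum_ord2 !mxE /al /be /D /=; apply/rowP => k.
by rewrite !mxE; field; rewrite eps0 D0.
Qed.

(** The left-hand side is a Christoffel contraction for a flat metric whose coframe
has derivatives x and y. *)
Lemma gram_raise (V : lmodType R) x y (P Q : V) :
  \sum_k (2^-1 * \sum_l invmx G k l * (2 * (x * a l + eps ^+ 2 * (y * b l)))) *:
    (a k *: P + b k *: Q) = x *: P + y *: Q.
Proof.
have e c d : c = x -> d = y -> c *: P + d *: Q = x *: P + y *: Q by move=> -> ->.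
rewrite gram_inverse !sum_ord2 !mxE /al /be /D /= !scalerDr !scalerA addrACA -!scalerDl.
by apply: e; field; rewrite eps0 D0.
Qed.

End two_by_two.

(** * The moving frame along a Hopf torus *)

Section frame_along.
Context {R : realType}.
Notation R4 := 'rV[R]_4.
Notation R3 := 'rV[R]_3.
Notation R2 := 'rV[R]_2.
Context {J : set R} {beta : R -> R3}.
Context {U : set R2} {F : R2 -> R4} {sigma : R2 -> R}.
Hypothesis J_open : open J.
Hypothesis beta_curve : arclength_curve J beta.
Hypothesis U_open : open U.
Hypothesis F_immersion : immersion U F.
Hypothesis sigma_smooth : smooth U sigma.
Hypothesis F_fiber : forall u, U u -> J (sigma u) /\ hopf_fiber (beta (sigma u)) (F u).

(** The frame along F: T is the horizontal lift of the velocity of the curve, V spans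
the fibre, and N = iT is the normal of the torus. *)
Definition frameT (u : R2) : R4 := lift (vel beta (sigma u)) (F u).
Definition frameN (u : R2) : R4 := iJ (frameT u).
Definition frameV (u : R2) : R4 := iJ (F u).
(** The coefficients of dF(v) on T and on V. *)
Definition coefT (v u : R2) : R := 'D_v sigma u.
Definition coefV (v u : R2) : R := dot ('D_v F u) (frameV u).

Let Js u : U u -> J (sigma u). Proof. by move=> /F_fiber[]. Qed.

Lemma F_sphere u : U u -> S3 (F u).
Proof. by move=> /F_fiber[_ []]. Qed.

Lemma hopf_F u : U u -> hopf (F u) = beta (sigma u).
Proof. by move=> /F_fiber[_ [_ h]]. Qed.

Lemma hopfb_F u : U u -> hopfb (F u) (F u) = 2 *: beta (sigma u).
Proof.
by move=> Uu; rewrite -hopf_F// hopfE scalerA divff ?scale1r// pnatr_eq0.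
Qed.

Lemma hasD_F' u v : U u -> hasD F u v ('D_v F u).
Proof. by case: F_immersion => /(_ 1%N)[h _] _ Uu; exact/diff_hasD/h. Qed.

Lemma hasD_sigma u v : U u -> hasD sigma u v (coefT v u).
Proof. by case: (sigma_smooth 1%N) => h _ Uu; exact/diff_hasD/h. Qed.

Lemma hasD_sigma_comp (W : normedModType R) (h : R -> W) u v d : U u ->
  hasD h (sigma u) 1 d -> hasD (fun u => h (sigma u)) u v (coefT v u *: d).
Proof. by move=> Uu hh; exact: hasD_comp (hasD_sigma v Uu) hh. Qed.

Lemma dot_F_T u : U u -> dot (F u) (frameT u) = 0.
Proof.
move=> Uu; rewrite dotC /frameT dot_lift_adj hopfb_F// dotZr.
by rewrite (dot_vel_beta J_open beta_curve (Js Uu)) mulr0.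
Qed.

Lemma dot_T_V u : dot (frameT u) (iJ (F u)) = 0.
Proof. by rewrite /frameT dot_lift_adj hopfb_iJ dot0r. Qed.

Lemma dot_T_T u : U u -> dot (frameT u) (frameT u) = 1.
Proof.
move=> Uu; rewrite /frameT dot_lift (F_sphere Uu : dot _ _ = 1).
by rewrite (dot_vel beta_curve (Js Uu)) mulr1.
Qed.

(** Differentiate hopf F = beta(sigma) and lift: the horizontal part of dF(v) is the
lift of d sigma(v) beta'. *)
Lemma hasD_F u v : U u -> hasD F u v (coefT v u *: frameT u + coefV v u *: frameV u).
Proof.
move=> Uu; apply: hasD_eq (hasD_F' v Uu) _.
have h1 : hasD (fun u => hopf (F u)) u v (hopfb (F u) ('D_v F u)).
  have [D E] := hasD_hopf (F u) ('D_v F u).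
  by apply: hasD_eq (hasD_chain (hasD_F' v Uu) D) E.
have h2 := hasD_sigma_comp v Uu (hasD_beta beta_curve (Js Uu)).
have h3 := hasD_open U_open Uu hopf_F h1.
have E : hopfb (F u) ('D_v F u) = coefT v u *: vel beta (sigma u).
  exact: etrans (esym (hasD_val h3)) (hasD_val h2).
have := lift_hopfb (F u) ('D_v F u).
rewrite E (linZ _ _ ((@lift_bil R).1 _)) (F_sphere Uu : dot _ _ = 1) scale1r.
by move=> /eqP; rewrite eq_sym subr_eq => /eqP.
Qed.

(** The rotation speed of the pair (T, N) in the flat ambient space. *)
Definition spin v u := kap beta (sigma u) * coefT v u + coefV v u.

Lemma lift_beta u : U u -> lift (2 *: beta (sigma u)) (F u) = F u.
Proof.
move=> Uu; rewrite -hopfb_F// lift_hopfb (F_sphere Uu : dot _ _ = 1) dot_iJ.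
by rewrite scale0r subr0 scale1r.
Qed.

Lemma lift_conormal u : U u -> lift (conormal beta (sigma u)) (F u) = frameN u.
Proof.
move=> Uu; have := iJ_lift (vel beta (sigma u)) (F u).
rewrite (F_sphere Uu : dot _ _ = 1) scale1r hopfb_F// dotZr.
rewrite (dot_vel_beta J_open beta_curve (Js Uu)) mulr0 scale0r addr0 /frameN /frameT => ->.
by rewrite conormalE.
Qed.

(** The acceleration of the curve contributes the curvature term and the motion of
the base point in the fibre rotates the lift. *)
Lemma hasD_T u v : U u -> hasD frameT u v (spin v u *: frameN u - coefT v u *: F u).
Proof.
move=> Uu; have ha := hasD_sigma_comp v Uu (hasD_vel beta_curve (Js Uu)).
apply: hasD_eq (hasD_bil (@lift_bil R) ha (hasD_F v Uu)) _.
have [Ll Lr] := @lift_bil R.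
rewrite (accE J_open beta_curve (Js Uu)).
have -> : kap beta (sigma u) *: conormal beta (sigma u) - 4 *: beta (sigma u) =
    kap beta (sigma u) *: conormal beta (sigma u) - 2 *: (2 *: beta (sigma u)).
  by rewrite scalerA; congr (_ - _ *: _); ring.
rewrite (linZ _ _ (Ll _)) (linD _ _ (Ll _)) (linN _ (Ll _)).
rewrite (linZ _ (conormal _ _) (Ll _)) (linZ _ (2 *: _) (Ll _)) lift_conormal// lift_beta//.
rewrite (linD _ _ (Lr _)) !(linZ _ _ (Lr _)) lift_lift.
rewrite (dot_vel beta_curve (Js Uu)) /frameV lift_iJ -/(frameT u) -/(frameN u) /spin.
move: (frameN u) (F u) => N p; apply/rowP => i; rewrite !mxE; ring.
Qed.

Lemma hasD_N u v : U u -> hasD frameN u v (- spin v u *: frameT u - coefT v u *: frameV u).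
Proof.
move=> Uu; apply: hasD_eq (hasD_iJ (hasD_T v Uu)) _.
by rewrite iJB !iJZ /frameN iJK scalerN scaleNr.
Qed.

Lemma hasD_V u v : U u -> hasD frameV u v (coefT v u *: frameN u - coefV v u *: F u).
Proof.
move=> Uu; apply: hasD_eq (hasD_iJ (hasD_F v Uu)) _.
by rewrite iJD !iJZ /frameV iJK scalerN.
Qed.

Definition dcoefT v w u := 'D_v (coefT w) u.
Definition dcoefV v w u := 'D_v (coefV w) u.

Lemma hasD_coefT v w u : U u -> hasD (coefT w) u v (dcoefT v w u).
Proof. by case: (sigma_smooth 2%N) => _ /(_ w)[h _] Uu; exact/diff_hasD/h. Qed.

Lemma hasD_coefV v w u : U u -> hasD (coefV w) u v (dcoefV v w u).
Proof.
move=> Uu; apply: diff_hasD.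
have D : differentiable ('D_w F) u.
  by case: F_immersion => /(_ 2%N)[_ /(_ w)[h _]] _; exact: h.
exact: hasD_diff (hasD_dot (diff_hasD v D) (hasD_V v Uu)).
Qed.

(** Both pairs of coefficients are closed 1-forms: the first is d sigma, the second
by the symmetry of the second derivatives of F, read off on V. *)
Lemma dcoefTC v w u : U u -> dcoefT v w u = dcoefT w v u.
Proof. by move=> Uu; exact: mixed_derive U_open Uu (sigma_smooth 2%N). Qed.

Lemma dcoefVC v w u : U u -> dcoefV v w u = dcoefV w v u.
Proof.
move=> Uu.
have E x y : dot ('D_x ('D_y F) u) (frameV u) = dcoefV x y u.
  have h : hasD ('D_y F) u x
      (dcoefT x y u *: frameT u + coefT y u *: (spin x u *: frameN u - coefT x u *: F u) +
       (dcoefV x y u *: frameV u + coefV y u *: (coefT x u *: frameN u - coefV x u *: F u))).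
    apply: (hasD_open U_open Uu (f := fun u => coefT y u *: frameT u + coefV y u *: frameV u)).
      by move=> q Uq; rewrite (hasD_val (hasD_F y Uq)).
    by apply: hasDD; apply: hasDZ; [exact: hasD_coefT|exact: hasD_T|exact: hasD_coefV|exact: hasD_V].
  rewrite (hasD_val h) /frameV /frameN !dotE.
  rewrite !(frame_dots (F_sphere Uu) (dot_T_T Uu) (dot_F_T Uu) (dot_T_V u)).
  move: (dcoefT x y u) (dcoefV x y u) (coefT x u) (coefT y u) (coefV x u) (coefV y u) (spin x u).
  by move=> *; ring.
have := mixed_derive_row w v U_open Uu (F_immersion.1 2%N) => M.
exact: etrans (esym (E v w)) (etrans (congr1 (fun x => dot x (frameV u)) M) (E w v)).
Qed.

Context {eps : R} {g : R4 -> R4 -> R4 -> R} {Gam : R4 -> R4 -> R4 -> R4}.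
Hypotheses (eps0 : eps != 0) (Bg : berger_metric eps g) (LC : levi_civita g Gam).
Notation e_ i := (delta_mx 0 i : R2).

(** The connection form of the pair (T, N) for the Berger metric. *)
Definition turn v u := kap beta (sigma u) * coefT v u + eps ^+ 2 * coefV v u.

Lemma partial_F i u : U u -> partial i F u = coefT (e_ i) u *: frameT u + coefV (e_ i) u *: frameV u.
Proof. by move=> Uu; exact: hasD_val (hasD_F (e_ i) Uu). Qed.

(** The moving frame equations, in the form of the covariant derivative of an
arbitrary field along F expressed in the frame. *)
Lemma covd_along_frame i W (t n v : R2 -> R) dt dn dv u : U u ->
  (forall q, U q -> W q = t q *: frameT q + n q *: frameN q + v q *: frameV q) ->
  hasD t u (e_ i) dt -> hasD n u (e_ i) dn -> hasD v u (e_ i) dv ->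
  covd_along Gam F i W u = (dt - n u * turn (e_ i) u) *: frameT u +
    (dn + t u * turn (e_ i) u + eps ^+ 2 * (v u * coefT (e_ i) u)) *: frameN u +
    (dv - n u * coefT (e_ i) u) *: frameV u.
Proof.
move=> Uu WE ht hn hv; set e := delta_mx 0 i.
have hW := hasD_open U_open Uu (fun q Uq => esym (WE q Uq))
  (hasDD (hasDD (hasDZ ht (hasD_T e Uu)) (hasDZ hn (hasD_N e Uu)))
         (hasDZ hv (hasD_V e Uu))).
have Fs := F_sphere Uu; have TT := dot_T_T Uu; have FT := dot_F_T Uu.
have TV := dot_T_V u.
have tF : tangent (F u) (partial i F u).
  rewrite partial_F//.
  by have := frame_tangent FT TV (coefT e u) 0 (coefV e u); rewrite scale0r addr0.
have tW : tangent (F u) (W u) by rewrite WE//; exact: frame_tangent.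
rewrite /covd_along (levi_civitaE eps0 Bg LC Fs tF tW).
rewrite [partial i W u](hasD_val hW) partial_F// WE//.
rewrite /frameV /frameN (berger_gam_frame Fs TT FT TV) -/(frameN u) -/(frameV u) /spin /turn.
rewrite -/e; move: (kap beta (sigma u)) (coefT e u) (coefV e u) (t u) (n u) (v u).
move: (F u) (frameT u) (frameN u) (frameV u) => p T N V k a b t0 n0 v0.
by apply/rowP => j; rewrite !mxE; ring.
Qed.

Lemma induced_metricE q j l : U q -> induced_metric g F q j l =
  coefT (e_ j) q * coefT (e_ l) q + eps ^+ 2 * (coefV (e_ j) q * coefV (e_ l) q).
Proof.
move=> Uq; rewrite mxE.
have Fs := F_sphere Uq; have TT := dot_T_T Uq; have FT := dot_F_T Uq.
have TV := dot_T_V q.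
have tF i : tangent (F q) (partial i F q).
  rewrite partial_F//.
  have := frame_tangent FT TV (coefT (e_ i) q) 0 (coefV (e_ i) q).
  by rewrite scale0r addr0.
by rewrite (berger_metricE Bg Fs (tF j) (tF l)) !partial_F// /frameV berger_dot_frame.
Qed.

(** A combination of directions on which both coefficients vanish is killed by dF. *)
Lemma immersion_independent (w0 w1 : R2) x y u : U u ->
  x * coefT w0 u + y * coefT w1 u = 0 -> x * coefV w0 u + y * coefV w1 u = 0 ->
  x *: w0 + y *: w1 = 0.
Proof.
move=> Uu ha hb; case: F_immersion => _ /(_ u Uu); apply.
have dF : differentiable F u by have [] := hasD_F' 0 Uu.
have E1 := derive_dirP x w0 (y *: w1) dF.
have E2 := derive_dirP y w1 0 dF; rewrite addr0 derive0 addr0 in E2.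
apply: (etrans E1); rewrite E2.
rewrite (hasD_val (hasD_F w0 Uu)) (hasD_val (hasD_F w1 Uu)).
move: (coefT w0 u) (coefT w1 u) (coefV w0 u) (coefV w1 u) (frameT u) (frameV u) ha hb.
move=> a0 a1 b0 b1 T V ha hb.
by rewrite !scalerDr !scalerA addrACA -!scalerDl ha hb !scale0r addr0.
Qed.

Lemma det_neq0 (a0 a1 b0 b1 : R) :
  (forall x y, x * a0 + y * a1 = 0 -> x * b0 + y * b1 = 0 -> x = 0 /\ y = 0) ->
  a0 * b1 - a1 * b0 != 0.
Proof.
move=> comb; apply/eqP => D0.
have [b1_0 /eqP] : b1 = 0 /\ - b0 = 0.
  by apply: comb; [rewrite -[RHS]D0|]; ring.
rewrite oppr_eq0 => /eqP b0_0.
have [a1_0 /eqP] : a1 = 0 /\ - a0 = 0.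
  by apply: comb; [ring|rewrite b0_0 b1_0; ring].
rewrite oppr_eq0 => /eqP a0_0.
have [||/eqP] := comb 1 0; rewrite ?a0_0 ?b0_0 ?mulr0 ?mul0r ?addr0//.
by rewrite oner_eq0.
Qed.

Lemma frame_det_neq0 u : U u ->
  coefT (e_ 0) u * coefV (e_ 1) u - coefT (e_ 1) u * coefV (e_ 0) u != 0.
Proof.
move=> Uu; apply: det_neq0 => x y ha hb.
have /rowP E := immersion_independent Uu ha hb.
have := E 0; have := E 1; rewrite !mxE !eqxx /=.
by rewrite !(mulr1, mulr0, addr0, add0r) => -> ->.
Qed.

Let H u := invmx (induced_metric g F u).

(** The induced metric is flat with closed coframe, so the three derivatives in the
Christoffel symbol combine into one term. *)
Lemma christoffelE k i j u : U u -> christoffel (induced_metric g F) k i j u =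
  2^-1 * \sum_l H u k l * (2 * (dcoefT (e_ i) (e_ j) u * coefT (e_ l) u +
                               eps ^+ 2 * (dcoefV (e_ i) (e_ j) u * coefV (e_ l) u))).
Proof.
move=> Uu.
have dG x y z : partial x (fun w => induced_metric g F w y z) u =
   dcoefT (e_ x) (e_ y) u * coefT (e_ z) u + coefT (e_ y) u * dcoefT (e_ x) (e_ z) u +
   eps ^+ 2 * (dcoefV (e_ x) (e_ y) u * coefV (e_ z) u + coefV (e_ y) u * dcoefV (e_ x) (e_ z) u).
  have h := hasDD (hasDM (hasD_coefT (e_ x) (e_ y) Uu) (hasD_coefT (e_ x) (e_ z) Uu))
    (hasDM (hasD_cst (eps ^+ 2) u (e_ x))
      (hasDM (hasD_coefV (e_ x) (e_ y) Uu) (hasD_coefV (e_ x) (e_ z) Uu))).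
  have {}h := hasD_open U_open Uu (fun q Uq => esym (induced_metricE y z Uq)) h.
  by apply: (etrans (hasD_val h)); rewrite mul0r add0r.
rewrite /christoffel; congr (_ * _); apply: eq_bigr => l _; congr (_ * _).
rewrite !dG (dcoefTC (e_ j) (e_ i) Uu) (dcoefVC (e_ j) (e_ i) Uu).
rewrite (dcoefTC (e_ l) (e_ i) Uu) (dcoefVC (e_ l) (e_ i) Uu).
rewrite (dcoefTC (e_ l) (e_ j) Uu) (dcoefVC (e_ l) (e_ j) Uu).
move: (dcoefT (e_ i) (e_ j) u) (dcoefT (e_ i) (e_ l) u) (dcoefT (e_ j) (e_ l) u).
move: (dcoefV (e_ i) (e_ j) u) (dcoefV (e_ i) (e_ l) u) (dcoefV (e_ j) (e_ l) u).
move: (coefT (e_ i) u) (coefT (e_ j) u) (coefT (e_ l) u) (coefV (e_ i) u) (coefV (e_ j) u) (coefV (e_ l) u).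
by move=> *; ring.
Qed.

(** Since the coefficients on T and V are closed, contracting the Christoffel symbols
with them returns their derivatives. *)
Lemma christoffel_sum i j u (X : 'I_2 -> R4) (P Q : R4) : U u ->
  (forall k, X k = coefT (e_ k) u *: P + coefV (e_ k) u *: Q) ->
  \sum_k christoffel (induced_metric g F) k i j u *: X k =
  dcoefT (e_ i) (e_ j) u *: P + dcoefV (e_ i) (e_ j) u *: Q.
Proof.
move=> Uu XE; have det := frame_det_neq0 Uu.
have := gram_raise (a := fun i => coefT (e_ i) u) (b := fun i => coefV (e_ i) u)
  eps0 det (fun i j => induced_metricE i j Uu)
  (dcoefT (e_ i) (e_ j) u) (dcoefV (e_ i) (e_ j) u) P Q => <-.
by apply: eq_bigr => k _; rewrite XE christoffelE.
Qed.

Lemma trace_sum u (X : 'I_2 -> 'I_2 -> R4) (P Q1 Q2 Q : R4) : U u ->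
  (forall i j, X i j = (coefT (e_ i) u * coefT (e_ j) u) *: P +
     (coefT (e_ i) u * coefV (e_ j) u) *: Q1 + (coefV (e_ i) u * coefT (e_ j) u) *: Q2 +
     (coefV (e_ i) u * coefV (e_ j) u) *: Q) ->
  \sum_i \sum_j invmx (induced_metric g F u) i j *: X i j = P + eps ^- 2 *: Q.
Proof.
move=> Uu XE; have det := frame_det_neq0 Uu.
have := gram_trace (a := fun i => coefT (e_ i) u) (b := fun i => coefV (e_ i) u)
  eps0 det (fun i j => induced_metricE i j Uu) P Q1 Q2 Q => <-.
by apply: eq_bigr => i _; apply: eq_bigr => j _; rewrite XE.
Qed.

(** Tangential parts cancel against the Christoffel terms; in the trace the mixed
products of coefficients disappear, leaving the curvature of the curve. *)
Lemma tensionE u : U u ->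
  tension Gam (induced_metric g F) F u = kap beta (sigma u) *: frameN u.
Proof.
move=> Uu; rewrite /tension.
rewrite (trace_sum (P := kap beta (sigma u) *: frameN u) (Q1 := eps ^+ 2 *: frameN u)
  (Q2 := eps ^+ 2 *: frameN u) (Q := 0) Uu) => [|i j]; first by rewrite scaler0 addr0.
have FE q : U q -> partial j F q = coefT (e_ j) q *: frameT q + 0 *: frameN q + coefV (e_ j) q *: frameV q.
  by move=> Uq; rewrite partial_F// scale0r addr0.
rewrite (covd_along_frame Uu FE (hasD_coefT _ _ Uu) (hasD_cst 0 _ _) (hasD_coefV _ _ Uu)).
rewrite (christoffel_sum (P := frameT u) (Q := frameV u) _ _ Uu) => [|k]; last exact: partial_F.
rewrite /turn.
move: (dcoefT (e_ i) (e_ j) u) (dcoefV (e_ i) (e_ j) u) (kap beta (sigma u)).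
move: (coefT (e_ i) u) (coefT (e_ j) u) (coefV (e_ i) u) (coefV (e_ j) u) (frameT u) (frameN u) (frameV u).
by move=> ? ? ? ? T N V ? ? ?; apply/rowP => k; rewrite !mxE; ring.
Qed.

(** The tension field and its first covariant derivative are both given in the frame,
so two applications of the frame equations give the rough Laplacian. *)
Lemma bitensionE u : U u ->
  bitension Gam (induced_metric g F) F u =
   (- 3 * kap beta (sigma u) * kap1 beta (sigma u)) *: frameT u +
   (kap2 beta (sigma u) - kap beta (sigma u) ^+ 3 +
      (4 - 4 * eps ^+ 2) * kap beta (sigma u)) *: frameN u +
   (- 2 * kap1 beta (sigma u)) *: frameV u.
Proof.
move=> Uu; pose k q := kap beta (sigma q); pose k1 q := kap1 beta (sigma q).
have hk x q : U q -> hasD k q x (coefT x q * k1 q).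
  by move=> Uq; have := hasD_sigma_comp x Uq (hasD_kap J_open beta_curve (Js Uq)).
have hk1 x q : U q -> hasD k1 q x (coefT x q * kap2 beta (sigma q)).
  by move=> Uq; have := hasD_sigma_comp x Uq (hasD_kap1 J_open beta_curve (Js Uq)).
pose tau := tension Gam (induced_metric g F) F.
have tauE q : U q -> tau q = 0 *: frameT q + k q *: frameN q + 0 *: frameV q.
  by move=> Uq; rewrite /tau tensionE// !scale0r addr0 add0r.
have hturn x y q : U q -> hasD (turn y) q x
    (coefT x q * k1 q * coefT y q + k q * dcoefT x y q + eps ^+ 2 * dcoefV x y q).
  move=> Uq; apply: hasD_eq (hasDD (hasDM (hk x q Uq) (hasD_coefT x y Uq))
    (hasDM (hasD_cst (eps ^+ 2) q x) (hasD_coefV x y Uq))) _.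
  by rewrite mul0r add0r.
have Dtau j q : U q -> covd_along Gam F j tau q =
    (- (k q * turn (e_ j) q)) *: frameT q + (k1 q * coefT (e_ j) q) *: frameN q +
    (- (k q * coefT (e_ j) q)) *: frameV q.
  move=> Uq.
  rewrite (covd_along_frame Uq tauE (hasD_cst 0 _ _) (hk _ _ Uq) (hasD_cst 0 _ _)).
  by rewrite !sub0r !mul0r mulr0 !addr0 (mulrC (coefT _ _)).
have htn j i := hasDN (hasDM (hk (e_ i) u Uu) (hturn (e_ i) (e_ j) u Uu)).
have hn j i := hasDM (hk1 (e_ i) u Uu) (hasD_coefT (e_ i) (e_ j) Uu).
have hv j i := hasDN (hasDM (hk (e_ i) u Uu) (hasD_coefT (e_ i) (e_ j) Uu)).
rewrite /bitension -/tau.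
rewrite (trace_sum Uu (P := (- 3 * k u * k1 u) *: frameT u +
    (kap2 beta (sigma u) - k u ^+ 3 - eps ^+ 2 * k u) *: frameN u - (2 * k1 u) *: frameV u)
  (Q1 := - (k1 u * eps ^+ 2) *: frameT u - (k u ^+ 2 * eps ^+ 2) *: frameN u)
  (Q2 := - (k1 u * eps ^+ 2) *: frameT u - (k u ^+ 2 * eps ^+ 2) *: frameN u)
  (Q := - (k u * eps ^+ 4) *: frameN u)) => [|i j]; last first.
  rewrite (covd_along_frame Uu (fun q => Dtau j q) (htn j i) (hn j i) (hv j i)).
  rewrite (christoffel_sum (P := k1 u *: frameN u - k u ^+ 2 *: frameT u - k u *: frameV u)
    (Q := - (k u * eps ^+ 2) *: frameT u) _ _ Uu) => [|l]; last first.
    rewrite Dtau// /turn -/(k u).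
    move: (coefT (e_ l) u) (coefV (e_ l) u) (k u) (k1 u) (frameT u) (frameN u) (frameV u).
    by move=> ? ? ? ? T N V; apply/rowP => r; rewrite !mxE; ring.
  rewrite /turn -/(k u).
  move: (kap2 beta (sigma u)) (dcoefT (e_ i) (e_ j) u) (dcoefV (e_ i) (e_ j) u) (k u) (k1 u).
  move: (coefT (e_ i) u) (coefT (e_ j) u) (coefV (e_ i) u) (coefV (e_ j) u) (frameT u) (frameN u) (frameV u).
  by move=> ? ? ? ? T N V ? ? ? ? ?; apply/rowP => r; rewrite !mxE; ring.
rewrite (trace_sum Uu (P := - (k u * (4 - 3 * eps ^+ 2)) *: frameN u) (Q1 := 0) (Q2 := 0)
  (Q := - (k u * eps ^+ 4) *: frameN u)) => [|i j]; last first.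
  rewrite /tau tensionE// !partial_F//.
  rewrite (riemann_frame (F_sphere Uu) (dot_T_T Uu) (dot_F_T Uu) (dot_T_V u) _ _ _ _ _
    eps0 Bg LC) -/(k u) -/(frameN u).
  move: (coefT (e_ i) u) (coefT (e_ j) u) (coefV (e_ i) u) (coefV (e_ j) u) (k u) (frameN u).
  by move=> ? ? ? ? ? N; apply/rowP => r; rewrite !mxE; ring.
rewrite -/(k u) -/(k1 u).
move: (kap2 beta (sigma u)) (k u) (k1 u) (frameT u) (frameN u) (frameV u) => c2 c c1 T N V.
by apply/rowP => r; rewrite !mxE; field.
Qed.

End frame_along.

(** * Existence of local parametrizations *)

Section local_parametrization.
Context {R : realType}.
Notation R4 := 'rV[R]_4.
Notation R3 := 'rV[R]_3.
Notation R2 := 'rV[R]_2.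
Context {J : set R} {beta : R -> R3}.
Hypothesis J_open : open J.
Hypothesis beta_curve : arclength_curve J beta.
Context {p0 : R4}.
Hypothesis p0_sphere : S3 p0.

Let m (s : R) : R := 2 + 8 * dot (hopf p0) (beta s).
Let J' : set R := [set s | J s /\ 0 < m s].
Let P (s : R) : R4 := (m s `^ (- 2^-1)) *: (p0 + lift (2 *: beta s) p0).
Let U : set R2 := [set u | J' (u 0 0)].
Let F (u : R2) : R4 := cos (u 0 1) *: P (u 0 0) + sin (u 0 1) *: iJ (P (u 0 0)).

Lemma base_open : open J'.
Proof.
rewrite openE => s [Js ms].
have cm : {for s, continuous m}.
  apply: differentiable_continuous.
  have h := hasD_dot (hasD_cst (hopf p0) s 1) (hasD_beta beta_curve Js).
  have h2 := hasDD (hasD_cst (2 : R) s 1) (hasDM (hasD_cst (8 : R) s 1) h).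
  exact: (hasD_diff h2).
have n1 : \forall t \near s, 0 < m t.
  exact: (cvgr_gt _ cm _ ms).
have n0 := near_open J_open Js (fun t (Jt : J t) => Jt).
by apply: filterS2 n0 n1 => t ? ?; split.
Qed.

Lemma chart_open : open U.
Proof.
apply: (open_comp (f := fun u : R2 => u 0 0)); last exact: base_open.
by move=> u _; exact: coord_continuous.
Qed.

(** The squared norm of p0 + lift (2 beta) p0 is 2 + 8 <hopf p0, beta>, which is
positive as long as beta avoids the antipode of hopf p0. *)
Lemma section_sphere s : J' s -> S3 (P s).
Proof.
move=> [Js ms]; rewrite /S3 /P /=; have := powR_invsqrt ms.
move: (_ `^ _) => a E; rewrite dotZl dotZr mulrA -expr2 -[RHS]E; congr (_ * _).
rewrite dotDl !dotDr (dotC p0 (lift _ _)) dot_lift dot_lift_adj.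
rewrite (p0_sphere : dot p0 p0 = 1) (dot_2beta beta_curve Js) dotZl.
rewrite /m hopfE dotZl (dotC (beta s)); by field.
Qed.

(** The fibre over y consists of the unit vectors fixed by the involution
lift (2 y); adding its image to p0 projects p0 to these fixed vectors. *)
Lemma lift_section s : J' s -> lift (2 *: beta s) (P s) = P s.
Proof.
move=> [Js _]; have Lr := (@lift_bil R).2; rewrite /P (linZ _ _ (Lr _)).
rewrite (linD _ _ (Lr _)) lift_lift (dot_2beta beta_curve Js) scale1r.
by rewrite [p0 + _]addrC.
Qed.

Lemma chart_sphere_lift u : U u ->
  S3 (F u) /\ lift (2 *: beta (u 0 0)) (F u) = F u.
Proof.
move=> Uu; have PP := section_sphere Uu; have LP := lift_section Uu; split.
  rewrite /S3 /F /=; move: (P _) (PP : dot _ _ = 1) => q qq.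
  rewrite !dotDl !dotDr !dotZl !dotZr dot_iJ dot_iJiJ (dotC (iJ q) q) dot_iJ qq.
  rewrite -[RHS](cos2Dsin2 (u 0 1)); ring.
have Lr := (@lift_bil R).2; rewrite /F; move: (P _) LP => q LP.
by rewrite (linD _ _ (Lr _)) !(linZ _ _ (Lr _)) lift_iJ LP.
Qed.

Lemma chart_fiber u : U u -> J (u 0 0) /\ hopf_fiber (beta (u 0 0)) (F u).
Proof.
move=> Uu; have [Fs LF] := chart_sphere_lift Uu; split; first by case: Uu.
split => //=; rewrite hopfE.
have := hopfb_lift (2 *: beta (u 0 0)) (F u).
rewrite LF (Fs : dot _ _ = 1) scale1r => ->.
by rewrite scalerA mulVf ?scale1r// pnatr_eq0.
Qed.

Lemma section_smooth : smooth J' P.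
Proof.
move=> k; have oJ := base_open.
have Cb : Ck k J' beta.
  by case: beta_curve => /(_ k) C _ _; apply: Ck_subset C => s [].
apply: CkZ => //.
  apply: (Ck_comp (h := fun x : R => x `^ (- 2^-1)) oJ _ _ (Ck_powR k _)).
    by move=> s [].
  apply: CkD => //; first exact: Ck_cst.
  apply: (Ck_lin (l := fun y : R3 => 8 * dot (hopf p0) y)) => // a u w.
  by rewrite dotDr dotZr mulrDr; congr (_ + _); exact: mulrCA.
apply: CkD => //; first exact: Ck_cst.
apply: (Ck_lin (l := fun y : R3 => lift (2 *: y) p0)) => // a u w.
by rewrite scalerDr scalerA mulrC -scalerA; exact: ((@lift_bil R).1 p0).
Qed.

Lemma chart_smooth : smooth U F.
Proof.
move=> k; have oU := chart_open.
have [Cs Cc] := @Ck_sin_cos R k.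
have CP : Ck k U (fun u => P (u 0 0)).
  apply: (Ck_comp (f := fun u : R2 => u 0 0) oU _ (Ck_coord k 0 oU) (section_smooth k)).
  by [].
have C1 := @Ck_coord R k 2 U 1 oU.
apply: CkD => //; apply: CkZ => //.
- exact: (Ck_comp (J := setT) oU _ C1 Cc).
- exact: (Ck_comp (J := setT) oU _ C1 Cs).
- by apply: Ck_lin => //; exact: iJ_lin.
Qed.

(** A vector killed by dF has no component along the curve, since F lies over beta;
the remaining component moves F along its fibre. *)
Lemma chart_immersion : immersion U F.
Proof.
split; first exact: chart_smooth.
move=> u Uu a Fa; have [Fs LF] := chart_sphere_lift Uu.
have DF : differentiable F u by have [h _] := chart_smooth 1%N; exact: h.
have Js : J (u 0 0) by case: Uu.
have hs : hasD (fun u : R2 => u 0 0) u a (a 0 0) := hasD_coord 0 (hasD_id u a).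
have ht : hasD (fun u : R2 => u 0 1) u a (a 0 1) := hasD_coord 1 (hasD_id u a).
have a0 : a 0 0 = 0.
  have [D E] := hasD_hopf (F u) ('D_a F u).
  have h1 := hasD_chain (diff_hasD a DF) D; rewrite E Fa in h1.
  have h2 := hasD_comp hs (hasD_beta beta_curve Js).
  have h3 := hasD_open chart_open Uu (fun q Uq => (chart_fiber Uq).2.2) h1.
  have := etrans (esym (hasD_val h2)) (hasD_val h3).
  rewrite (lin0 ((@hopfb_bil R).2 _)) => v0.
  have := dot_vel beta_curve Js => v1.
  have := congr1 (fun w => dot w (vel beta (u 0 0))) v0.
  by rewrite dot0l dotZl v1 mulr1.
have hP : hasD P (u 0 0) 1 ('D_1 P (u 0 0)).
  by apply: diff_hasD; have [h _] := section_smooth 1%N; exact: h.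
have hPu := hasD_comp hs hP; rewrite a0 scale0r in hPu.
have hcos := hasD_comp ht (hasD_real 1 (is_derive_cos (u 0 1))).
have hsin := hasD_comp ht (hasD_real 1 (is_derive_sin (u 0 1))).
have hF := hasDD (hasDZ hcos hPu) (hasDZ hsin (hasD_iJ hPu)).
have E : a 0 1 *: iJ (F u) = 0.
  rewrite -Fa; apply: (etrans _ (esym (hasD_val hF))).
  rewrite (lin0 iJ_lin) !scaler0 !addr0 /F.
  rewrite ![_ *: (1 *: _)]mulrCA !mul1r.
  move: (P _) (cos _) (sin _) => q c d; rewrite iJD !iJZ iJK.
  by move: (iJ q) => Jq; apply/rowP => i; rewrite !mxE; ring.
have a1 : a 0 1 = 0.
  have := congr1 (fun w => dot w (iJ (F u))) E.
  by rewrite dot0l dotZl dot_iJiJ (Fs : dot _ _ = 1) mulr1.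
by apply/rowP; apply: ord2P; rewrite mxE.
Qed.

Lemma parametrization_at s : J' s -> exists (U : set R2) (F : R2 -> R4)
  (sigma : R2 -> R) (u : R2), [/\ open U, immersion U F, smooth U sigma,
    (forall u, U u -> J (sigma u) /\ hopf_fiber (beta (sigma u)) (F u)) &
    U u /\ sigma u = s].
Proof.
move=> Js; exists U, F, (fun u => u 0 0), (s *: delta_mx 0 0).
have E : (s *: delta_mx 0 0 : R2) 0 0 = s by rewrite !mxE mulr1.
split; [exact: chart_open|exact: chart_immersion| |exact: chart_fiber|].
  by move=> k; apply: Ck_coord; exact: chart_open.
by split => //; rewrite /U /= E.
Qed.

End local_parametrization.

(** Projecting the point (1, 0) or (0, 1) of S^3 to the fibres and rotating by exp(i t)
parametrizes the torus over points in the upper or lower closed hemisphere. *)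
Lemma local_parametrization (R : realType) (J : set R) (beta : R -> 'rV[R]_3) s :
  open J -> arclength_curve J beta -> J s ->
  exists (U : set 'rV[R]_2) (F : 'rV[R]_2 -> 'rV[R]_4)
  (sigma : 'rV[R]_2 -> R) (u : 'rV[R]_2), [/\ open U, immersion U F, smooth U sigma,
    (forall u, U u -> J (sigma u) /\ hopf_fiber (beta (sigma u)) (F u)) &
    U u /\ sigma u = s].
Proof.
move=> oJ bc Js.
pose n : 'rV[R]_4 := vec4 1 0 0 0; pose z : 'rV[R]_4 := vec4 0 0 1 0.
have Sn : S3 n by rewrite /S3 /= /n !coordE; ring.
have Sz : S3 z by rewrite /S3 /= /z !coordE; ring.
have [b0|b0] := leP 0 (beta s 0 2).
  apply: (parametrization_at oJ bc Sn); split => //.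
  rewrite hopfE /hopfb /n !coordE !mxE ?coordE /= ?mxE /=; lra.
apply: (parametrization_at oJ bc Sz); split => //.
rewrite hopfE /hopfb /z !coordE !mxE ?coordE /= ?mxE /=; lra.
Qed.

(** * Circles and constant curvature *)

Section circles.
Context {R : realType}.
Notation R3 := 'rV[R]_3.
Context {J : set R} {beta : R -> R3}.
Hypothesis J_open : open J.
Hypothesis beta_curve : arclength_curve J beta.
Notation kap := (kap beta).
Notation conormal := (conormal beta).
Notation vel := (vel beta).

Lemma dot_conormal_beta s : dot (conormal s) (beta s) = 0.
Proof.
rewrite /conormal dotZl; have -> : dot (cross (vel s) (beta s)) (beta s) = 0.
  by move: (vel s) (beta s) => u w; dots.
by rewrite mulr0.
Qed.

(** The vector k (2 beta) + 2 conormal is constant along the curve; it is the axis of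
the circle. *)
Lemma constant_curvature_circle k r : J !=set0 -> is_interval J ->
  (forall s, J s -> kap s = k) -> 0 < r -> r ^+ 2 * (k ^+ 2 + 4) = 1 ->
  arc_of_circle J beta r.
Proof.
move=> [s0 Js0] Ji kapE r0 rE; split => //.
pose n s : R3 := k *: (2 *: beta s) + 2 *: conormal s.
have hn s : J s -> hasD n s 1 0.
  move=> Js; have hb := hasD_beta beta_curve Js.
  have hv := hasD_conormal J_open beta_curve Js; rewrite (kapE s Js) in hv.
  have h := hasDD (hasDZ (hasD_cst k s 1) (hasDZ (hasD_cst (2 : R) s 1) hb))
    (hasDZ (hasD_cst (2 : R) s 1) hv).
  apply: hasD_eq h _; rewrite !scale0r !add0r !scalerA -scalerDl.
  by rewrite (_ : _ + _ = 0) ?scale0r//; ring.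
have nE s : J s -> n s = n s0.
  move=> Js; apply/rowP => i.
  apply: (derive0_constant (f := fun s => n s 0 i) Ji _ Js Js0) => t Jt.
  by apply: hasD_eq (hasD_coord i (hn t Jt)) _; rewrite mxE.
set c := n s0 in nE.
have cb s : J s -> dot c (beta s) = k / 2.
  move=> Js; rewrite -(nE s Js) /n; have := dot_conormal_beta s.
  have := dot_beta beta_curve Js; move: (conormal s) (beta s) => x y yy xy.
  by rewrite dotDl !dotZl xy yy; field.
have cc : dot c c = k ^+ 2 + 4.
  have := dot_conormal_beta s0; have := dot_beta beta_curve Js0.
  have := dot_conormal J_open beta_curve Js0; rewrite /c /n.
  move: (conormal s0) (beta s0) => x y xx yy xy.
  by rewrite dotDl !dotDr !dotZl !dotZr (dotC y x) xx yy xy; field.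
have k4 : 0 < k ^+ 2 + 4 by rewrite ltr_wpDl ?sqr_ge0.
have k4n : k ^+ 2 + 4 != 0 by rewrite gt_eqF.
have rE' : r ^+ 2 = (k ^+ 2 + 4)^-1 by apply: (mulIf k4n); rewrite rE mulVf.
exists c, ((k / 2 / (k ^+ 2 + 4)) *: c); split.
- by apply/eqP => c0; move: cc; rewrite c0 dot0l => /esym/eqP; rewrite (negbTE k4n).
- move=> y [/= cy yr]; rewrite /S2half /=.
  have -> : y = (y - (k / 2 / (k ^+ 2 + 4)) *: c) + (k / 2 / (k ^+ 2 + 4)) *: c.
    by rewrite subrK.
  move: (y - _) cy yr => d cd dd.
  rewrite dotDl !dotDr !dotZl !dotZr (dotC d c) cd dd cc rE'.
  by field.
move=> _ [s Js <-]; split => /=.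
  by rewrite dotDr dotNr dotZr cb// cc; field.
rewrite dotDl !dotDr !dotNl !dotNr !dotZl !dotZr (dotC (beta s) c) cb// cc.
by rewrite (dot_beta beta_curve Js) rE'; field.
Qed.

(** As the circle lies on the sphere, its centre c satisfies <c, beta> = |c|^2 and
|c|^2 + r^2 = 1/4.  Differentiating
the first relation twice and expanding c in the Frenet frame gives the
curvature. *)
Lemma circle_curvature r : r ^+ 2 < 4^-1 -> arc_of_circle J beta r ->
  forall s, J s -> r ^+ 2 * (kap s ^+ 2 + 4) = 1.
Proof.
move=> rlt [r0 [n [c [_ sub img]]]].
have circ s : J s -> circle n c r (beta s) by move=> Js; apply: img; exists s.
have sph s : J s -> dot c (beta s - c) = 0 /\ dot c c + r ^+ 2 = 4^-1.
  move=> Js; have [/= nd dd] := circ s Js.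
  have E1 := sub _ (circ s Js).
  (* the antipodal point on the circle *)
  have E2 : S2half (c - (beta s - c)).
    apply: sub; rewrite /circle /= [c - _ - c]addrAC subrr sub0r.
    by rewrite !dotNr dotNl opprK nd oppr0.
  move: E1 E2; rewrite /S2half /= -{1 2}(subrK c (beta s)).
  move: (beta s - c) nd dd => d nd dd.
  rewrite !(dotDl, dotDr) !(dotNl, dotNr) (dotC d c) dd => E1 E2.
  split; first by lra.
  by move: E1 E2; lra.
have cb s : J s -> dot c (beta s) = dot c c.
  by move=> /sph[h _]; move/eqP: h; rewrite dotDr dotNr subr_eq0 => /eqP.
move=> s Js; have [_ cE] := sph s Js.
have cc0 : dot c c != 0 by apply/eqP => E; move: cE rlt; rewrite E; lra.
have c1 t : J t -> dot c (vel t) = 0.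
  move=> Jt; have h := hasD_dot (hasD_cst c t 1) (hasD_beta beta_curve Jt).
  by have := hasD_const_open J_open Jt cb h; rewrite dot0l add0r.
have c2 : dot c (acc beta s) = 0.
  have h := hasD_dot (hasD_cst c s 1) (hasD_vel beta_curve Js).
  by have := hasD_const_open J_open Js c1 h; rewrite dot0l add0r.
have kn : kap s * dot c (conormal s) = 4 * dot c c.
  move: c2; rewrite (accE J_open beta_curve Js) dotDr dotNr !dotZr (cb s Js).
  by move/eqP; rewrite subr_eq0 => /eqP.
have f0 : dot (vel s) (2 *: beta s) = 0.
  by rewrite dotZr (dot_vel_beta J_open beta_curve Js) mulr0.
have := orthonormal_expand c (dot_vel beta_curve Js) (dot_2beta beta_curve Js) f0.
rewrite -conormalE (c1 s Js) scale0r addr0 dotZr (cb s Js) => cexp.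
have cn : dot c c = dot c (conormal s) ^+ 2 + 4 * dot c c ^+ 2.
  have := congr1 (dot c) cexp; move: (conormal s) => x.
  rewrite dotDr !dotZr (cb s Js) => h; apply: (etrans h); ring.
have q : dot c (conormal s) ^+ 2 = 4 * r ^+ 2 * dot c c.
  have -> : r ^+ 2 = 4^-1 - dot c c by rewrite -cE; ring.
  have -> : dot c (conormal s) ^+ 2 = dot c c - 4 * dot c c ^+ 2 by rewrite {1}cn; ring.
  by field.
have sq : kap s ^+ 2 * r ^+ 2 = 4 * dot c c.
  have h : kap s ^+ 2 * dot c (conormal s) ^+ 2 = (4 * dot c c) ^+ 2.
    by rewrite -exprMn kn.
  apply: (mulIf cc0); rewrite q in h.
  by apply: (mulIf (_ : 4 != 0 :> R)) => //; rewrite -[RHS]mulrA [RHS]mulrC; move: h; lra.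
rewrite mulrDr mulrC sq; move: cE; lra.
Qed.

End circles.

(** * The characterization *)

Lemma adapted_frame_independent (R : realType) (p T : 'rV[R]_4) t n v : S3 p ->
  dot T T = 1 -> dot p T = 0 -> dot T (iJ p) = 0 ->
  t *: T + n *: iJ T + v *: iJ p = 0 -> n = 0 /\ v = 0.
Proof.
move=> Sp TT pT TJ E; have dots := frame_dots Sp TT pT TJ; split.
  have := congr1 (fun w => dot w (iJ T)) E.
  by rewrite !dotE !dots !mulr0 mulr1 add0r addr0.
have := congr1 (fun w => dot w (iJ p)) E.
by rewrite !dotE !dots !mulr0 mulr1 !add0r.
Qed.

Theorem theorem2p3 (R : realType) (eps : R)
    (g : 'rV[R]_4 -> 'rV[R]_4 -> 'rV[R]_4 -> R)
    (Gam : 'rV[R]_4 -> 'rV[R]_4 -> 'rV[R]_4 -> 'rV[R]_4)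
    (J : set R) (beta : R -> 'rV[R]_3)
    (eps_neq0 : eps != 0)
    (g_berger : berger_metric eps g)
    (Gam_levi_civita : levi_civita g Gam)
    (J_neq0 : J !=set0) (J_open : open J) (J_itv : is_interval J)
    (beta_curve : arclength_curve J beta) :
  proper_biharmonic_surface g Gam (hopf_torus J beta) <->
  eps ^+ 2 < 1 /\ arc_of_circle J beta (1 / (2 * Num.sqrt (2 - eps ^+ 2))).
Proof.
pose k := kap beta; set r := 1 / _.
have r2 : eps ^+ 2 < 1 -> 0 < r /\ r ^+ 2 * (4 * (2 - eps ^+ 2)) = 1.
  move=> e1; have x0 : 0 < 2 - eps ^+ 2 by lra.
  have s0 : 0 < Num.sqrt (2 - eps ^+ 2) by rewrite sqrtr_gt0.
  split; first by rewrite /r divr_gt0// mulr_gt0.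
  have := sqr_sqrtr (ltW x0); rewrite /r; move: (Num.sqrt _) s0 => s s0 <-.
  by field; rewrite gt_eqF.
have harmonicP : harmonic_surface g Gam (hopf_torus J beta) <->
    forall s, J s -> k s = 0.
  split=> [H s Js|H U F [/= oU iF [sigma [ss fib]]] u Uu].
    have [U [F [sigma [u [oU iF ss fib [Uu us]]]]]] :=
      local_parametrization J_open beta_curve Js.
    have TT := dot_T_T beta_curve fib Uu.
    have : tension Gam (induced_metric g F) F u = 0.
      by apply: (H U F) Uu; split=> //; exists sigma.
    rewrite (tensionE J_open beta_curve oU iF ss fib eps_neq0 g_berger
      Gam_levi_civita Uu) us => /(congr1 (fun w => dot w (frameN (beta := beta) (F := F) (sigma := sigma) u))).
    by rewrite dotZl dot0l /frameN dot_iJiJ TT mulr1.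
  rewrite (tensionE J_open beta_curve oU iF ss fib eps_neq0 g_berger
      Gam_levi_civita Uu) -/k H ?scale0r//.
  by have [] := fib u Uu.
have biharmonicP : biharmonic_surface g Gam (hopf_torus J beta) <->
    forall s, J s -> kap1 beta s = 0 /\
      kap2 beta s - k s ^+ 3 + (4 - 4 * eps ^+ 2) * k s = 0.
  split=> [H s Js|H U F [/= oU iF [sigma [ss fib]]] u Uu].
    have [U [F [sigma [u [oU iF ss fib [Uu us]]]]]] :=
      local_parametrization J_open beta_curve Js.
    have : bitension Gam (induced_metric g F) F u = 0.
      by apply: (H U F) Uu; split=> //; exists sigma.
    rewrite (bitensionE J_open beta_curve oU iF ss fib eps_neq0 g_berger
      Gam_levi_civita Uu) us.
    move=> /(adapted_frame_independent (F_sphere fib Uu) (dot_T_T beta_curve fib Uu)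
      (dot_F_T J_open beta_curve fib Uu) (dot_T_V u))[-> /eqP].
    by rewrite mulf_eq0 oppr_eq0 pnatr_eq0 => /eqP.
  rewrite (bitensionE J_open beta_curve oU iF ss fib eps_neq0 g_berger
      Gam_levi_civita Uu) -/k.
  have [Js _] := fib u Uu; have [-> ->] := H _ Js.
  by rewrite !mulr0 !scale0r !addr0.
have Dk s : J s -> hasD k s 1 (kap1 beta s) by exact: hasD_kap.
have Dk1 s : J s -> hasD (kap1 beta) s 1 (kap2 beta s) by exact: hasD_kap1.
rewrite /proper_biharmonic_surface; split=> [[/biharmonicP B nH]|[e1 arc]].
  have [s0 Js0] := J_neq0.
  have kE s : J s -> k s = k s0.
    move=> Js; apply: (derive0_constant J_itv _ Js Js0) => t Jt.
    by apply: hasD_eq (Dk t Jt) (B t Jt).1.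
  have k0 : k s0 != 0.
    apply/eqP => k0; apply: nH; apply/harmonicP => s Js.
    by rewrite kE.
  have k2 : k s0 ^+ 2 = 4 - 4 * eps ^+ 2.
    have [_] := B s0 Js0.
    rewrite (hasD_const_open J_open Js0 (fun s Js => (B s Js).1) (Dk1 s0 Js0)).
    by move=> h; apply: (mulIf k0); move: h; lra.
  have e1 : eps ^+ 2 < 1.
    have : 0 < k s0 ^+ 2 by rewrite lt_neqAle sqr_ge0 andbT eq_sym sqrf_eq0.
    by rewrite k2; lra.
  split=> //; have [r0 rE] := r2 e1.
  apply: (constant_curvature_circle J_open beta_curve J_neq0 J_itv kE r0).
  by rewrite k2 -[RHS]rE; ring.
have [r0 rE] := r2 e1.
have e0 : 0 < eps ^+ 2 by rewrite lt_neqAle sqr_ge0 andbT eq_sym sqrf_eq0.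
have rn : r ^+ 2 != 0 by rewrite sqrf_eq0 gt_eqF.
have r4 : r ^+ 2 < 4^-1.
  have rp : 0 < r ^+ 2 by rewrite exprn_gt0.
  have : r ^+ 2 * 4 < 1 by rewrite -[ltRHS]rE ltr_pM2l//; lra.
  by move=> h; lra.
have k2 s : J s -> k s ^+ 2 = 4 - 4 * eps ^+ 2.
  move=> Js; have h := circle_curvature J_open beta_curve r4 arc Js.
  have : k s ^+ 2 + 4 = 4 * (2 - eps ^+ 2) by apply: (mulfI rn); rewrite h rE.
  by lra.
have kn s : J s -> k s != 0.
  by move=> Js; rewrite -sqrf_eq0 k2// gt_eqF//; lra.
have k10 s : J s -> kap1 beta s = 0.
  move=> Js; have := hasD_const_open J_open Js k2 (hasDM (Dk s Js) (Dk s Js)).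
  move: (kap1 beta s) (k s) (kn s Js) => a b b0 h.
  by apply: (mulIf b0); rewrite mul0r; lra.
split; last first.
  by move/harmonicP => H; have [s Js] := J_neq0; move: (kn s Js); rewrite H// eqxx.
apply/biharmonicP => s Js; rewrite k10//; split => //.
rewrite (hasD_const_open J_open Js k10 (Dk1 s Js)) [_ ^+ 3]exprS k2//; ring.
Qed.
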